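(* Let $G$ be a planar graph with maximum degree $\Delta\geq 28$ and let $H$ be a subgraph of $G$ that is a matching (i.e., $H$ consists of vertex-disjoint copies of $K_2$). Then any total-$(\Delta+3)$-coloring of $H$ in $G$ can be extended to a total-$(\Delta+3)$-coloring of $G$.
   Context: All graphs are simple. A total-$k$-coloring of a graph is an assignment of colors from $\{1,\dots,k\}$ to its vertices and edges such that adjacent vertices receive different colors, adjacent edges (edges sharing an endpoint) receive different colors, and no edge receives the same color as either of its endpoints. For a subgraph $H$ of $G$, a total-$k$-coloring $\varphi$ of $H$ is a total-$k$-coloring of $H$ in $G$ if, in addition, $\varphi(u)\neq\varphi(v)$ for all $u,v\in V(H)$ that are adjacent in $G$ (i.e., $\varphi$ is also proper with respect to $G$). Extending $\varphi$ to $G$ means finding a total-$k$-coloring of $G$ that agrees with $\varphi$ on all vertices and edges of $H$. *)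

(* Defs.v *)
From Stdlib Require Import Reals.
From mathcomp Require Import all_boot.

Set Implicit Arguments.
Unset Strict Implicit.
Unset Printing Implicit Defensive.

Section Graphs.
Variable T : finType.

Definition simple_graph (e : rel T) : Prop :=
  (forall u v, e u v = e v u) /\ (forall v, ~~ e v v).

Definition degree (e : rel T) (v : T) : nat := #|[set u | e v u]|.
Definition max_degree (e : rel T) : nat := \max_(v : T) degree e v.

Definition planar_embedding (e : rel T) (pos : T -> (R * R)%type)
    (arc : T -> T -> R -> (R * R)%type) : Prop :=
  injective pos /\
  (forall x y, e x y ->
     arc x y R0 = pos x /\ arc x y R1 = pos y /\
     continuity (fun t => fst (arc x y t)) /\
     continuity (fun t => snd (arc x y t)) /\
     (forall s t, Rle R0 s /\ Rle s R1 -> Rle R0 t /\ Rle t R1 ->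
        arc x y s = arc x y t -> s = t) /\
     (forall z t, Rlt R0 t /\ Rlt t R1 -> arc x y t <> pos z)) /\
  (forall x y x' y', e x y -> e x' y' ->
     ~ ((x = x' /\ y = y') \/ (x = y' /\ y = x')) ->
     forall s t, Rlt R0 s /\ Rlt s R1 -> Rlt R0 t /\ Rlt t R1 -> arc x y s <> arc x' y' t).

Definition planar (e : rel T) : Prop :=
  exists pos arc, planar_embedding e pos arc.

Definition total_coloring (e : rel T) (k : nat) (vc : T -> nat)
    (ec : T -> T -> nat) : Prop :=
  (forall v, 1 <= vc v <= k) /\
  (forall u v, e u v ->
     [/\ 1 <= ec u v <= k, ec u v = ec v u, vc u <> ec u v & vc u <> vc v]) /\
  (forall u v w, e u v -> e u w -> v <> w -> ec u v <> ec u w).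

(* The subgraph H given by its edge relation eH (vertex set = covered vertices). *)
Definition in_sub (eH : rel T) (v : T) : Prop := exists u, eH v u.

Definition matching_subgraph (e eH : rel T) : Prop :=
  (forall u v, eH u v = eH v u) /\
  (forall u v, eH u v -> e u v) /\
  (forall u v w, eH u v -> eH u w -> v = w).

Definition total_coloring_in (e eH : rel T) (k : nat) (vc : T -> nat)
    (ec : T -> T -> nat) : Prop :=
  (forall v, in_sub eH v -> 1 <= vc v <= k) /\
  (forall u v, eH u v ->
     [/\ 1 <= ec u v <= k, ec u v = ec v u & vc u <> ec u v]) /\
  (forall u v, in_sub eH u -> in_sub eH v -> e u v -> vc u <> vc v) /\
  (forall u v w, eH u v -> eH u w -> v <> w -> ec u v <> ec u w).

Definition extends_to (e eH : rel T) (k : nat) (vc : T -> nat)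
    (ec : T -> T -> nat) : Prop :=
  exists vc' ec', total_coloring e k vc' ec' /\
    (forall v, in_sub eH v -> vc' v = vc v) /\
    (forall u v, eH u v -> ec' u v = ec u v).

End Graphs.

(* Main.v *)
From Stdlib Require Import Reals Lra ZArith.
Require Import Defs.
From mathcomp Require Import all_boot boolp zify.

Set Implicit Arguments.
Unset Strict Implicit.
Unset Printing Implicit Defensive.

(** Write [D] for the maximum degree. The vertices are coloured greedily, as
[D + 3 > D]. An edge [uv] outside [H] then keeps a list of colours whose size is at
least the degrees of [u] and [v] in [G - H], and at least [D - 1 >= 27]. A graph
[F] with such lists is coloured by induction. If some edge [uv] has
[d(u) + d(v) <= |L(uv)| + 1], it can be coloured last. If there is a nonempty set
[X] of vertices of degree at most 5, all of whose neighbours have at least 5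
neighbours in [X], then the edges at [X] can be coloured last, by the variant of
Galvin's theorem of Borodin, Kostochka and Woodall. Otherwise all the vertices of
degree at most 5 can be charged to neighbours of degree at least 24, at most four
to each, and this contradicts [m <= 3 n].

The bound [m <= 3 n] is extracted from a topological embedding by showing that the
graph is a minor of a fine square grid. Modulo 2, cycles of a grid minor lift to
cycles of the grid, which bound sets of unit squares, so that the cycle space of
the minor is generated by the boundaries of its faces. *)

(** The constants. An edge [uv] outside [H] loses two of the [D + 3] colours to its ends and one to
    each edge of [H] at [u] or [v], so it keeps at least [D + 1 - dH(u) - dH(v)]. As
    [d(u) <= D - dH(u)] and [dH(v) <= 1], this is at least [d(u)]. If no edge can be coloured last,
    then [d(u) + d(v) >= 27 + 2] on every edge, so a vertex of degree at most 5 has only neighbours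
    of degree at least 24. Such a neighbour has a surplus of 18 over the average 6, and pays at most
    [4 * 4 = 16], as a vertex of degree at least 2 needs at most 4.

    The bound [m <= 3 n] lacks the [- 6] of Euler's bound, which spares any discussion of
    connectedness; in return the discharging must also exclude equality, and does so with a vertex
    of degree at least 7. Planarity enters only through this bound for all subgraphs, so the
    discharging cannot use faces. *)

(** * Edges of minors of the square grid *)

Definition adj4 (p q : nat * nat) : bool :=
  (p.1 == q.1) && ((p.2 == q.2.+1) || (q.2 == p.2.+1)) ||
  (p.2 == q.2) && ((p.1 == q.1.+1) || (q.1 == p.1.+1)).

Inductive cconn (C : pred (nat * nat)) (p : nat * nat) : nat * nat -> Prop :=
| cconn_refl : C p -> cconn C p p
| cconn_step q r : cconn C p q -> C r -> adj4 q r -> cconn C p r.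

Definition gend (b : bool) (i j : nat) : nat * nat :=
  if b then (i.+1, j) else (i, j.+1).

Definition chain := bool -> nat -> nat -> bool.

(** The boundary modulo 2. Since [i.-1] is truncated at 0, it is meaningful at positive coordinates
    only, and branch sets are kept off the row and column 0. *)
Definition bnd (z : chain) (i j : nat) : bool :=
  z true i j (+) z true i.-1 j (+) z false i j (+) z false i j.-1.

Definition elem (b : bool) (i j : nat) : chain :=
  fun b' i' j' => [&& b' == b, i' == i & j' == j].

Lemma bnd_elem b i j k l : 0 < k -> 0 < l ->
  bnd (elem b i j) k l = ((k, l) == (i, j)) (+) ((k, l) == gend b i j).
Proof.
case: k => // k _; case: l => // l _; rewrite /bnd /elem /gend.
by case: b => /=; rewrite !xpair_eqE !eqSS ?addbF //;
  case: (k.+1 == i); case: (l.+1 == j); case: (k == i); case: (l == j).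
Qed.

Definition addc (z w : chain) : chain := fun b i j => z b i j (+) w b i j.

Lemma bnd_add z w i j : bnd (addc z w) i j = bnd z i j (+) bnd w i j.
Proof.
rewrite /bnd /addc.
by case: (z true i j); case: (z true i.-1 j); case: (z false i j);
  case: (z false i j.-1); rewrite /= ?addbT ?addbF ?addTb ?negb_add;
  case: (w true i j); case: (w true i.-1 j); case: (w false i j);
  case: (w false i j.-1).
Qed.

Lemma adj4_elem p q : adj4 p q ->
  exists b i j, ((p, q) = ((i, j), gend b i j)) \/ ((q, p) = ((i, j), gend b i j)).
Proof.
case: p q => [a b] [c d]; rewrite /adj4 /=.
case/orP => /andP[/eqP -> /orP[] /eqP ->].
- by exists false, c, d; right.
- by exists false, c, b; left.
- by exists true, c, d; right.
- by exists true, a, d; left.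
Qed.

Lemma cconn_in C p q : cconn C p q -> C p /\ C q.
Proof. by elim=> [//|q' r _ [Cp _] Cr _]. Qed.

Lemma cconn_chain C p q : cconn C p q ->
  exists z : chain, (forall b i j, z b i j -> C (i, j) /\ C (gend b i j)) /\
    forall i j, 0 < i -> 0 < j -> bnd z i j = ((i, j) == p) (+) ((i, j) == q).
Proof.
elim=> [Cp|q' r cpq [z [zC bz]] Cr aqr].
  by exists (fun _ _ _ => false); split=> // i j _ _; rewrite addbb.
have [_ Cq] := cconn_in cpq.
have [b [i [j H]]] := adj4_elem aqr.
exists (addc z (elem b i j)); split=> [b' i' j'|i' j' i0 j0].
  rewrite /addc /elem; case: (boolP [&& _, _ & _]) => [/and3P[/eqP-> /eqP-> /eqP->] _|_].
    by case: H => -[? ?]; subst.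
  by rewrite addbF; apply: zC.
rewrite bnd_add bz // bnd_elem //.
by case: H => -[-> ->]; case: (_ == p); case: (_ == _); case: (_ == _).
Qed.

(** * Sets of unit squares bounded by a grid cycle *)

Section Ray.
Variables (M : nat) (z : chain).
Hypothesis zM : forall b i j, z b i j -> (gend b i j).2 < M.
Hypothesis bz : forall i j, 0 < i -> 0 < j -> bnd z i j = false.

(* Parity of the number of horizontal edges of [z] met by the vertical ray
   issued upwards from the centre of the unit square [(i, j)]. *)
Definition ray (i j : nat) : bool := \big[addb/false]_(j.+1 <= l < M) z true i l.

Lemma ray_hor i j : z true i j.+1 = ray i j (+) ray i j.+1.
Proof.
rewrite /ray; have [lt_jM|le_Mj] := ltnP j.+1 M.
  by rewrite big_ltn // -addbA addbb addbF.
rewrite !big_geq ?addbF //; last exact: leq_trans le_Mj _.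
by apply/negbTE/negP => /zM /=; rewrite ltnNge le_Mj.
Qed.

(** The rays from the two sides of a vertical edge run on both sides of the line [i.+1]. As [z] has
    no boundary at the points of this line above the edge, the difference of the two counts
    telescopes along it. *)
Lemma ray_ver i j : z false i.+1 j = ray i j (+) ray i.+1 j.
Proof.
have zf k : M <= k.+1 -> z false i.+1 k = false.
  by move=> le_Mk; apply/negbTE/negP => /zM /=; rewrite ltnNge le_Mk.
rewrite /ray.
have [lt_jM|le_Mj] := ltnP j.+1 M; last by rewrite !big_geq ?addbF ?zf.
rewrite -big_split /=.
have -> : \big[addb/false]_(j.+1 <= l < M) (z true i l (+) z true i.+1 l) =
          \big[addb/false]_(j.+1 <= l < M) (z false i.+1 l (+) z false i.+1 l.-1).
  apply: eq_big_nat => l /andP[jl _].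
  have l0 : 0 < l by apply: leq_trans jl.
  have := bz (ltn0Sn i) l0; rewrite /bnd /=.
  by case: (z true _ _); case: (z true _ _); case: (z false _ _); case: (z false _ _).
have H n : j.+1 <= n ->
  \big[addb/false]_(j.+1 <= l < n) (z false i.+1 l (+) z false i.+1 l.-1) =
  z false i.+1 n.-1 (+) z false i.+1 j.
  elim: n => // n IH; rewrite ltnS leq_eqVlt => /orP[/eqP <-|lt_jn].
    by rewrite big_geq //= addbb.
  by rewrite big_nat_recr //= IH // [X in X (+) _]addbC -addbA addbA
    [_ (+) (_ (+) _)]addbC -addbA [X in _ (+) X]addbCA addbb addbF addbC.
rewrite H //; last exact: ltnW.
by rewrite (zf M.-1) ?leqSpred.
Qed.
End Ray.

Lemma big_shift n (c a : nat -> bool) : c 0 = false -> c n = false ->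
  \big[addb/false]_(i < n) (c i && a i.-1) =
  \big[addb/false]_(i < n) (c i.+1 && a i).
Proof.
case: n => [|n] c0 cn; first by rewrite !big_ord0.
rewrite big_ord_recl /= c0 /= big_ord_recr /= cn /= addbF.
exact: eq_bigr.
Qed.

Section GridMinor.
Variables (T E : finType) (src tgt : E -> T) (N : nat).
Variable cls : T -> pred (nat * nat).
Let M := N.+1.
Hypothesis cls_disj : forall v w p, cls v p -> cls w p -> v = w.
Hypothesis cls_bnd : forall v p, cls v p -> [&& 0 < p.1, p.1 < N, 0 < p.2 & p.2 < N].
Hypothesis cls_conn : forall v p q, cls v p -> cls v q -> cconn (cls v) p q.
Hypothesis edge_adj : forall e, exists p q,
  [/\ cls (src e) p, cls (tgt e) q & adj4 p q].
Hypothesis edge_irr : forall e, src e != tgt e.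

Definition inc (e : E) (v : T) : bool := (v == src e) || (v == tgt e).

Hypothesis edge_simple : forall e f, (forall v, inc e v = inc f v) -> e = f.

Lemma inc_addb e v : inc e v = (v == src e) (+) (v == tgt e).
Proof.
rewrite /inc; have := edge_irr e.
by case: (v =P src e) => [->|_ _] //= /negbTE->.
Qed.

Let GE := (bool * ('I_M * 'I_M))%type.
Let Sq := ('I_M * 'I_M)%type.
Definition sq (i j : nat) : 'I_M * 'I_M := (inord i, inord j).
(* The grid edge [(b, (i, j))] joins [(i, j)] to [gend b i j], so it separates the
   unit squares [side1 g] and [g.2], a square being named by its lowest corner. *)
Definition side1 (g : GE) : Sq :=
  if g.1 then sq g.2.1 (g.2.2 : nat).-1 else sq (g.2.1 : nat).-1 g.2.2.
Definition gbeg (g : GE) : nat * nat := (val g.2.1, val g.2.2).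
Definition gfin (g : GE) : nat * nat := gend g.1 g.2.1 g.2.2.

Lemma edge_grid e : exists g : GE,
  (cls (src e) (gbeg g) && cls (tgt e) (gfin g)) ||
  (cls (tgt e) (gbeg g) && cls (src e) (gfin g)).
Proof.
have [p [q [cp cq apq]]] := edge_adj e.
have [b [i [j H]]] := adj4_elem apq.
have [iM jM] : i < M /\ j < M.
  have /and4P[_ p1 _ p2] := cls_bnd cp; have /and4P[_ q1 _ q2] := cls_bnd cq.
  by case: H => -[? ?]; subst; split; apply: ltnW.
exists (b, (Ordinal iM, Ordinal jM)); rewrite /gbeg /gfin /=.
by case: H => -[<- <-]; rewrite cp cq ?orbT.
Qed.

Variable gE : E -> GE.
Hypothesis gEP : forall e,
  (cls (src e) (gbeg (gE e)) && cls (tgt e) (gfin (gE e))) ||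
  (cls (tgt e) (gbeg (gE e)) && cls (src e) (gfin (gE e))).

Lemma cls_gE e v : cls v (gbeg (gE e)) (+) cls v (gfin (gE e)) = inc e v.
Proof.
rewrite inc_addb.
have clsE u p : cls u p -> cls v p = (v == u).
  move=> cup; apply/idP/eqP => [cvp|-> //]; exact: cls_disj cvp cup.
case/orP: (gEP e) => /andP[/clsE-> /clsE->] //.
exact: addbC.
Qed.

Lemma gE_inj : injective gE.
Proof. by move=> e f eq_g; apply: edge_simple => v; rewrite -!cls_gE eq_g. Qed.

Definition con (p q : nat * nat) : bool := [exists v, cls v p && cls v q].
(* Edges contracted to, or representing edges of, the minor; the other ones are
   deleted, which merges the two adjacent squares. *)
Definition kept (g : GE) : bool := con (gbeg g) (gfin g) || [exists e, g == gE e].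

Lemma gE_ncon e : con (gbeg (gE e)) (gfin (gE e)) = false.
Proof.
apply/negbTE/negP => /existsP[v /andP[c1 c2]].
have clsE u p : cls u p -> cls v p -> v = u by move=> cup cvp; exact: cls_disj cvp cup.
have := edge_irr e.
by case/orP: (gEP e) => /andP[/clsE E1 /clsE E2]; rewrite -E1 // -E2 // eqxx.
Qed.

(** The grid edge [gE e] is prolonged by paths inside the two branch sets up to their
    representatives. These paths use contracted edges only, so they do not cancel [gE e]; and with
    all boundaries at representatives, the lifts of the edges of a cycle add up to a cycle. *)
Lemma lift_edge e (rep : T -> nat * nat) :
  (forall v p, cls v p -> cls v (rep v)) ->
  exists z : chain,
  [/\ forall b i j, z b i j -> con (i, j) (gend b i j) \/
         [/\ b = (gE e).1, i = (gE e).2.1 & j = (gE e).2.2],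
      z (gE e).1 (gE e).2.1 (gE e).2.2 &
      forall i j, 0 < i -> 0 < j ->
        bnd z i j = ((i, j) == rep (src e)) (+) ((i, j) == rep (tgt e))].
Proof.
move=> repP.
have [u [w [cu cw uw]]] : exists u w, [/\ cls u (gbeg (gE e)), cls w (gfin (gE e)) &
   (u, w) = (src e, tgt e) \/ (u, w) = (tgt e, src e)].
  by case/orP: (gEP e) => /andP[c1 c2]; [exists (src e), (tgt e)|exists (tgt e), (src e)];
    split=> //; [left|right].
have [z1 [z1C bz1]] := cconn_chain (cls_conn cu (repP _ _ cu)).
have [z2 [z2C bz2]] := cconn_chain (cls_conn cw (repP _ _ cw)).
have nc := gE_ncon e.
move: cu cw nc bz1 bz2; case: (gE e) => b [i j] /= cu cw nc bz1 bz2.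
exists (addc (elem b i j) (addc z1 z2)); split.
- move=> b' i' j'; rewrite /addc /elem.
  case: (boolP [&& _, _ & _]) => [/and3P[/eqP-> /eqP-> /eqP->] _|_]; first by right.
  rewrite addFb; case: (boolP (z1 b' i' j')) => [/z1C[c1 c2] _|_].
    by left; apply/existsP; exists u; rewrite c1.
  rewrite addFb => /z2C[c1 c2].
  by left; apply/existsP; exists w; rewrite c1.
- rewrite /addc /elem !eqxx /=.
  have /negbTE-> : ~~ z1 b i j.
    apply/negP => /z1C[c1 c2]; case/negP: (negbT nc).
    by apply/existsP; exists u; rewrite c1.
  have /negbTE-> // : ~~ z2 b i j.
  apply/negP => /z2C[c1 c2]; case/negP: (negbT nc).
  by apply/existsP; exists w; rewrite c1.
- move=> k l k0 l0; rewrite !bnd_add bnd_elem // bz1 // bz2 // /gbeg /gfin /=.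
  by case: uw => -[-> ->]; case: (_ == _); case: (_ == _); case: (_ == _); case: (_ == _).
Qed.

(** The boundary of the sum of the lifts counts, at [rep v], the edges of [Z] at [v]; it vanishes,
    and the ray parities give [S]. Deleted grid edges do not occur in the lifts, so [S] does not
    change across them. *)
Lemma lift_cycle (Z : E -> bool) :
  (forall v, \big[addb/false]_e (Z e && inc e v) = false) ->
  exists S : Sq -> bool,
    (forall g, ~~ kept g -> S (side1 g) = S g.2) /\
    forall e, Z e = S (side1 (gE e)) (+) S (gE e).2.
Proof.
move=> cycZ.
(* A vertex with an empty class gets a dummy representative; it is the end of no edge. *)
have /fin_all_exists[rep repP] : forall v, exists p, forall q, cls v q -> cls v p.
  move=> v; have [[p cp]|nop] := pselect (exists p, cls v p); first by exists p.
  by exists (0, 0) => q cq; case: nop; exists q.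
have /fin_all_exists[ze zeP] := fun e => lift_edge e repP.
pose z : chain := fun b i j => \big[addb/false]_e (Z e && ze e b i j).
have zP b i j : z b i j -> exists2 e, Z e & ze e b i j.
  move=> zt; apply/exists_inP/negbNE/negP => /exists_inPn nz.
  move: zt; rewrite /z big1 // => e _; case: (boolP (Z e)) => //= Ze.
  exact/negbTE/nz.
have z_in b i j : z b i j -> (exists v, cls v (i, j)) /\ exists v, cls v (gend b i j).
  case/zP => e _; have [h _ _] := zeP e; case/h => [/existsP[v /andP[c1 c2]]|].
    by split; exists v.
  case=> -> -> ->; case/orP: (gEP e) => /andP[c1 c2]; split;
   by [exists (src e)|exists (tgt e)].
have zM b i j : z b i j -> (gend b i j).2 < M.
  by case/z_in => _ [v /cls_bnd/and4P[_ _ _ /ltnW]].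
have bz i j : 0 < i -> 0 < j -> bnd z i j = false.
  move=> i0 j0.
  have -> : bnd z i j = \big[addb/false]_e (Z e && bnd (ze e) i j).
    rewrite /bnd /z -!big_split /=; apply: eq_bigr => e _.
    by case: (Z e).
  have -> : \big[addb/false]_e (Z e && bnd (ze e) i j) =
    \big[addb/false]_e \big[addb/false]_v (((i, j) == rep v) && (Z e && inc e v)).
    apply: eq_bigr => e _; have [_ _ ->] // := zeP e.
    case: (Z e) => /=; last by rewrite big1 // => v _; rewrite andbF.
    rewrite (bigD1 (src e)) //= (bigD1 (tgt e)) /=; last by rewrite eq_sym edge_irr.
    rewrite !inc_addb !eqxx [tgt e == _]eq_sym (negbTE (edge_irr e)) !andbT.
    rewrite big1 ?addbF // => v /andP[/negbTE v1 /negbTE v2].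
    by rewrite inc_addb v1 v2 andbF.
  rewrite exchange_big big1 // => v _; case: (_ == _); last by rewrite big1.
  exact: cycZ.
exists (fun s : Sq => ray M z s.1 s.2).
have zS (g : GE) : z g.1 g.2.1 g.2.2 = ray M z (side1 g).1 (side1 g).2 (+) ray M z g.2.1 g.2.2.
  case: g => [[] [[i iM] [j jM]]]; rewrite /side1 /=.
    (* On the border, truncation makes the two sides of [g] coincide, and [z] vanishes there because
       no class reaches the border. *)
    case: j jM => [|j] jM.
      rewrite !inordK // addbb; apply/negbTE/negP => /z_in[[v /cls_bnd]].
      by rewrite /= !andbF.
    by rewrite !inordK //= ?(ltnW jM) // (ray_hor zM).
  case: i iM => [|i] iM.
    rewrite !inordK // addbb; apply/negbTE/negP => /z_in[[v /cls_bnd]].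
    by [].
  by rewrite !inordK //= ?(ltnW iM) // (ray_ver zM bz).
split=> [g nkg|e]; last first.
  rewrite -zS /z (bigD1 e) //=; have [_ -> _] := zeP e.
  rewrite andbT big1 ?addbF // => f /negbTE nfe.
  case: (boolP (ze f _ _ _)) => [|_]; last exact: andbF.
  have [h _ _] := zeP f; case/h => [|[h1 h2 h3]].
    have := gE_ncon e; rewrite /gbeg /gfin /= => -> //.
  have /gE_inj ef : gE e = gE f.
    move: h1 h2 h3; case: (gE e) => [b [i j]]; case: (gE f) => [b' [i' j']] /=.
    by move=> -> /val_inj-> /val_inj->.
  by rewrite ef eqxx in nfe.
case: (boolP (z g.1 g.2.1 g.2.2)) (zS g) => [/zP[e _] zt _|_]; last first.
  by move=> /=; case: (ray _ _ _ _); case: (ray _ _ _ _).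
case/negP: nkg; move: zt.
have [h _ _] := zeP e; case/h => [cg|[h1 h2 h3]]; first by apply/orP; left.
apply/orP; right; apply/existsP; exists e; apply/eqP.
move: h1 h2 h3; case: (gE e) => [b [i j]]; case: g => [b' [i' j']] /=.
by move=> -> /val_inj-> /val_inj->.
Qed.

(** The connected components of this relation are the faces of the minor, each named by its
    [root]. *)
Definition dual : rel Sq := fun s t =>
  [exists g, ~~ kept g && (((s, t) == (side1 g, g.2)) || ((t, s) == (side1 g, g.2)))].

Lemma dual_sym : connect_sym dual.
Proof.
apply: sym_connect_sym => s t; apply: eq_existsb => g.
by rewrite orbC.
Qed.

Lemma root_dual g : ~~ kept g -> root dual (side1 g) = root dual g.2.
Proof.
move=> nk; apply/(rootP dual_sym)/connect1/existsP; exists g.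
by rewrite nk eqxx.
Qed.

Lemma const_dual (S : Sq -> bool) : (forall g, ~~ kept g -> S (side1 g) = S g.2) ->
  forall s, S s = S (root dual s).
Proof.
move=> HS; suff H s t : connect dual s t -> S s = S t by move=> s; apply/H/connect_root.
case/connectP=> p; elim: p s => [|u p IH] s /=; first by move=> _ ->.
case/andP=> /existsP[g /andP[nk su]] pp lp; rewrite -(IH u pp lp).
by case/orP: su => /eqP[-> ->]; rewrite HS.
Qed.

(** Modulo 2, an edge with the face [f] on both sides is not on its boundary. *)
Definition bdr (f : Sq) (e : E) : bool :=
  (root dual (side1 (gE e)) == f) (+) (root dual (gE e).2 == f).

(** Around a grid point, the changes of membership in [f] between consecutive squares cancel. In the
    sum over the points of the class of [v], grid edges inside the class count twice and deleted
    ones have the same face on both sides, so that only the edges [gE e] at [v] remain. *)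
Lemma face_cycle f v : \big[addb/false]_e (bdr f e && inc e v) = false.
Proof.
pose chi i j := root dual (sq i j) == f.
pose d (b : bool) i j := if b then chi i j.-1 (+) chi i j else chi i.-1 j (+) chi i j.
pose d' (g : GE) := d g.1 g.2.1 g.2.2.
have sq_id (s : Sq) : sq s.1 s.2 = s by case: s => i j; rewrite /sq !inord_val.
have d'E g : d' g = (root dual (side1 g) == f) (+) (root dual g.2 == f).
  by case: g => [[] s]; rewrite /d' /d /side1 /chi /= sq_id.
have loc i j : cls v (i, j) && (d true i j (+) d true i.-1 j (+) (d false i j (+) d false i j.-1)) = false.
  by case: (cls v _) => //; rewrite /d; case: (chi i j); case: (chi i.-1 j);
    case: (chi i j.-1); case: (chi i.-1 j.-1).
have c0 p : ~~ [&& 0 < p.1, p.1 < N, 0 < p.2 & p.2 < N] -> cls v p = false.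
  by move=> h; apply/negbTE/(contra _ h) => /cls_bnd.
have sumE : \big[addb/false]_(g : GE) ((cls v (gbeg g) (+) cls v (gfin g)) && d' g) = false.
  rewrite -(pair_bigA _ (fun b p => (cls v (gbeg (b, p)) (+) cls v (gfin (b, p))) && d' (b, p))).
  rewrite big_bool /=.
  rewrite -(pair_bigA _ (fun i j => (cls v (gbeg (true, (i, j))) (+) cls v (gfin (true, (i, j)))) && d' (true, (i, j)))).
  rewrite -(pair_bigA _ (fun i j => (cls v (gbeg (false, (i, j))) (+) cls v (gfin (false, (i, j)))) && d' (false, (i, j)))).
  rewrite /gbeg /gfin /d' /=.
  under eq_bigr do (under eq_bigr do rewrite andb_addl; rewrite big_split).
  rewrite big_split /=.
  under [X in _ (+) X]eq_bigr do (under eq_bigr do rewrite andb_addl; rewrite big_split).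
  rewrite [X in _ (+) X]big_split /=.
  rewrite [X in (_ (+) X) (+) _]exchange_big /=.
  have shH (j : 'I_M) : \big[addb/false]_(i < M) (cls v (i.+1, j : nat) && d true i j) =
    \big[addb/false]_(i < M) (cls v (i : nat, j : nat) && d true i.-1 j).
    rewrite -(@big_shift M (fun i => cls v (i, j : nat)) (fun i => d true i j)) //.
      by rewrite c0.
    by rewrite c0 //= ltnNge leqnSn.
  have shV (i : 'I_M) : \big[addb/false]_(j < M) (cls v (i : nat, j.+1) && d false i j) =
    \big[addb/false]_(j < M) (cls v (i : nat, j : nat) && d false i j.-1).
    rewrite -(@big_shift M (fun j => cls v (i : nat, j)) (fun j => d false i j)) //.
      by rewrite c0 //= !andbF.
    by rewrite c0 //= [N.+1 < N]ltnNge leqnSn !andbF.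
  under [X in (_ (+) X) (+) _]eq_bigr do rewrite shH.
  under [X in _ (+) (_ (+) X)]eq_bigr do rewrite shV.
  rewrite [X in (_ (+) X) (+) _]exchange_big /= -!big_split /=.
  rewrite big1 // => i _; rewrite -!big_split big1 //= => j _.
  by rewrite -[RHS](loc i j); case: (cls v _).
rewrite -[RHS]sumE (bigID (mem [set gE e | e in E])) /=.
rewrite [X in _ (+) X]big1 => [|g gn]; last first.
  case: (boolP (kept g)) => [|nk]; last by rewrite d'E root_dual // addbb andbF.
  case/orP => [/existsP[w /andP[w1 w2]]|/existsP[e /eqP ge]].
    have -> : cls v (gbeg g) = cls v (gfin g).
      by apply/idP/idP => h; [rewrite (cls_disj h w1)|rewrite (cls_disj h w2)].
    by rewrite addbb.
  by rewrite ge imset_f in gn.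
rewrite addbF big_imset /=; last by move=> e e' _ _; apply: gE_inj.
apply: eq_bigr => e _; rewrite cls_gE d'E andbC //.
Qed.

(** Each end of [e0] carries another edge of [Z], and these two edges differ, since otherwise they
    would be parallel to [e0]. *)
Lemma cycle_card (Z : E -> bool) (e0 : E) :
  (forall v, \big[addb/false]_e (Z e && inc e v) = false) -> Z e0 ->
  2 < #|[set e | Z e]|.
Proof.
move=> cyc Z0.
have other e v : Z e -> inc e v -> exists f, [/\ f != e, Z f & inc f v].
  move=> Ze iev; case: (pickP (fun f => [&& f != e, Z f & inc f v])) => [f /and3P|h].
    by exists f.
  have := cyc v; rewrite (bigD1 e) //= Ze iev big1 // => f ne.
  by have := h f; rewrite ne.
have [is0 it0] : inc e0 (src e0) /\ inc e0 (tgt e0) by rewrite /inc !eqxx orbT.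
have [f [fe Zf sf]] := other _ _ Z0 is0.
have [g [ge Zg tg]] := other _ _ Z0 it0.
have fg : f != g.
  apply: contraNneq fe => fg; apply/eqP/edge_simple => v; rewrite -fg in tg.
  have := edge_irr e0; move: sf tg; rewrite /inc.
  by do 2!case/orP=> /eqP->; rewrite ?eqxx // orbC.
rewrite cardE; apply: (@uniq_leq_size _ [:: e0; f; g]) => [|e].
  by rewrite /= !inE negb_or ![e0 == _]eq_sym fe ge fg.
by rewrite mem_enum !inE => /or3P[] /eqP->.
Qed.

(* Writing [m] for the number of edges, [n] for the number of their ends and [f]
   for the number of faces with a nonempty boundary, the cycle space has at least
   2 ^ (m - n) elements, all of them sums of face boundaries: m - n <= f. Each
   such boundary is a cycle, hence has at least 3 edges: 3 f <= 2 m. *)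
Lemma grid_minor_card_aux : #|E| <= 3 * #|[set v | [exists e, inc e v]]|.
Proof.
set V := [set v | _]; pose Fc := [set f | [exists e, bdr f e]].
have le_F : 3 * #|Fc| <= 2 * #|E|.
  rewrite mulnC -sum_nat_const.
  apply: (@leq_trans (\sum_(f in Fc) #|[set e | bdr f e]|)).
    apply: leq_sum => f; rewrite inE => /existsP[e be].
    exact: cycle_card (face_cycle f) be.
  rewrite (eq_bigr (fun f => \sum_e bdr f e)); last first.
    by move=> f _; rewrite -sum1_card big_mkcond; apply: eq_bigr => e _; rewrite inE; case: bdr.
  rewrite exchange_big /= mulnC -sum_nat_const; apply: leq_sum => e _.
  apply: (@leq_trans (\sum_(f in [set root dual (side1 (gE e)); root dual (gE e).2]) 1)).
    rewrite big_mkcond [X in _ <= X]big_mkcond; apply: leq_sum => f _.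
    rewrite !inE /bdr ![f == _]eq_sym.
    by case: ifP => // _; case: (_ == f); case: (_ == f).
  by rewrite sum1_card cards2; case: (_ != _).
suff le_E : #|E| <= #|V| + #|Fc|.
  rewrite -(leq_add2r (2 * #|E|)) -mulSn mulnC.
  rewrite mulnC; apply: leq_trans (leq_mul (leqnn 3) le_E) _.
  by rewrite mulnDr leq_add2l.
pose bd (Z : {ffun E -> bool}) : {set T} := [set v | \big[addb/false]_e (Z e && inc e v)].
(* One edge set is fixed for each possible boundary; adding it to [Z] gives a cycle [nz Z], which
   replaces a dimension count by a count of pairs. *)
pose sc (U : {set T}) : {ffun E -> bool} := odflt [ffun=> false] [pick Z | bd Z == U].
have scP Z : bd (sc (bd Z)) = bd Z.
  by rewrite /sc; case: pickP => [W /eqP|/(_ Z)] //=; rewrite eqxx.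
pose nz (Z : {ffun E -> bool}) e := Z e (+) sc (bd Z) e.
have nz_cyc Z v : \big[addb/false]_e (nz Z e && inc e v) = false.
  have : (v \in bd (sc (bd Z))) = (v \in bd Z) by rewrite scP.
  rewrite !inE /nz; under [in X in _ -> X]eq_bigr do rewrite andb_addl.
  by rewrite big_split /= => ->; rewrite addbb.
have /fin_all_exists[S SP] := fun Z => lift_cycle (nz_cyc Z).
(* [Z] is recovered from its boundary and from the faces filled by [nz Z]; a face with empty
   boundary has no influence on any edge. Hence [2 ^ m <= 2 ^ n * 2 ^ f]. *)
pose phi Z := (bd Z, [set f in Fc | S Z f]).
have phi_inj : injective phi.
  move=> Z W [eq_bd eq_S]; apply/ffunP => e.
  suff : nz Z e = nz W e by rewrite /nz eq_bd => /addIb.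
  have [cZ ->] := SP Z; have [cW ->] := SP W.
  rewrite [S Z (side1 _)](const_dual cZ) [S Z (gE e).2](const_dual cZ).
  rewrite [S W (side1 _)](const_dual cW) [S W (gE e).2](const_dual cW).
  have [->|neq] := eqVneq (root dual (side1 (gE e))) (root dual (gE e).2).
    by rewrite !addbb.
  have inF f : bdr f e -> S Z f = S W f.
    move=> bf; have /setP/(_ f) := eq_S; rewrite !inE.
    by have -> : [exists e, bdr f e] by apply/existsP; exists e.
  by rewrite !inF // /bdr ?eqxx ?[_ == root _ (side1 _)]eq_sym (negbTE neq).
rewrite -(leq_exp2l (m := 2)) // expnD -!card_powerset -cardsX.
have <- : #|phi @: setT| = 2 ^ #|E|.
  by rewrite card_imset // cardsT card_ffun card_bool.
apply/subset_leq_card/subsetP => _ /imsetP[Z _ ->]; rewrite !inE /=.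
apply/andP; split; apply/subsetP => x; rewrite !inE; last by case/andP.
apply: contraLR => /existsPn h; rewrite big1 // => e _.
by rewrite (negbTE (h e)) andbF.
Qed.
End GridMinor.

Lemma grid_minor_card (T E : finType) (src tgt : E -> T) (N : nat)
    (cls : T -> pred (nat * nat)) :
  (forall v w p, cls v p -> cls w p -> v = w) ->
  (forall v p, cls v p -> [&& 0 < p.1, p.1 < N, 0 < p.2 & p.2 < N]) ->
  (forall v p q, cls v p -> cls v q -> cconn (cls v) p q) ->
  (forall e, exists p q, [/\ cls (src e) p, cls (tgt e) q & adj4 p q]) ->
  (forall e, src e != tgt e) ->
  (forall e f, inc src tgt e =1 inc src tgt f -> e = f) ->
  #|E| <= 3 * #|[set v | [exists e, inc src tgt e v]]|.
Proof.
move=> disj bd conn adj irr simp.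
have /fin_all_exists[gE gEP] := edge_grid bd adj.
exact: grid_minor_card_aux disj bd conn irr simp gE gEP.
Qed.

(** * Grid minors from plane embeddings *)

Lemma fin_small (I : finType) (P : I -> R -> Prop) :
  (forall i d d', Rlt 0 d' -> Rle d' d -> P i d -> P i d') ->
  (forall i, exists d, Rlt 0 d /\ P i d) -> exists d, Rlt 0 d /\ forall i, P i d.
Proof.
move=> mono /fin_all_exists[f fP].
have H (s : seq I) : exists d, Rlt 0 d /\ forall i, i \in s -> P i d.
  elim: s => [|i s [d [d0 IH]]]; first by exists R1; split=> //; lra.
  have [fi0 Pi] := fP i.
  exists (Rmin d (f i)); split; first exact: Rmin_glb_lt.
  have m0 := Rmin_glb_lt _ _ _ d0 fi0.
  move=> j; rewrite inE => /orP[/eqP->|js]; first exact: mono m0 (Rmin_r _ _) Pi.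
  exact: mono m0 (Rmin_l _ _) (IH j js).
have [d [d0 dP]] := H (enum I); exists d; split=> // i.
by apply: dP; rewrite mem_enum.
Qed.

(** * Distances between points and compact curves *)

Section Distance.
Local Open Scope R_scope.

Definition dist1 (p q : R * R) : R := Rabs (p.1 - q.1) + Rabs (p.2 - q.2).

Lemma dist1_ge0 p q : 0 <= dist1 p q.
Proof. by apply: Rplus_le_le_0_compat; apply: Rabs_pos. Qed.

Lemma dist1_eq0 p q : dist1 p q = 0 -> p = q.
Proof.
case: p q => [a b] [c d]; rewrite /dist1 /= => h.
have := Rle_abs (a - c); have := Rle_abs (- (a - c)); rewrite Rabs_Ropp => h1 h2.
have := Rle_abs (b - d); have := Rle_abs (- (b - d)); rewrite Rabs_Ropp => h3 h4.
have := Rabs_pos (a - c); have := Rabs_pos (b - d) => h5 h6.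
by congr pair; lra.
Qed.

Lemma dist1_triangle q p r : dist1 p r <= dist1 p q + dist1 q r.
Proof.
rewrite /dist1.
have := Rabs_triang (p.1 - q.1) (q.1 - r.1); have := Rabs_triang (p.2 - q.2) (q.2 - r.2).
have -> : p.1 - q.1 + (q.1 - r.1) = p.1 - r.1 by ring.
have -> : p.2 - q.2 + (q.2 - r.2) = p.2 - r.2 by ring.
lra.
Qed.

Lemma dist1_sym p q : dist1 p q = dist1 q p.
Proof. by rewrite /dist1 Rabs_minus_sym [X in _ + X]Rabs_minus_sym. Qed.

Definition curve (g : R -> R * R) :=
  continuity (fun t => (g t).1) /\ continuity (fun t => (g t).2).

Lemma dist1_continuity g p : curve g -> continuity (fun t => dist1 p (g t)).
Proof.
move=> [g1 g2]; apply: continuity_plus.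
  apply: (continuity_comp (fun t => p.1 - (g t).1) Rabs); last exact: Rcontinuity_abs.
  by apply: continuity_minus => //; apply: continuity_const.
apply: (continuity_comp (fun t => p.2 - (g t).2) Rabs); last exact: Rcontinuity_abs.
by apply: continuity_minus => //; apply: continuity_const.
Qed.

Lemma curve_near g t0 eps : curve g -> 0 < eps ->
  exists d, 0 < d /\ forall t, Rabs (t - t0) < d -> dist1 (g t) (g t0) < eps.
Proof.
move=> cg e0; have /(_ t0 eps e0) := dist1_continuity (g t0) cg.
case=> d [d0 dP]; exists d; split=> // t lt; rewrite dist1_sym.
have gg : dist1 (g t0) (g t0) = 0 by rewrite /dist1 !Rminus_diag Rabs_R0; lra.
have [->|ne] := pselect (t = t0); first by rewrite gg.
have := dP t; rewrite /D_x /no_cond /R_dist gg /= /R_dist Rminus_0_r.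
move=> /(_ (conj (conj I (not_eq_sym ne)) lt)).
by rewrite Rabs_right //; apply/Rle_ge/dist1_ge0.
Qed.

Lemma curve_point_separation g p a b : curve g -> a <= b ->
  (forall t, a <= t <= b -> g t <> p) ->
  exists d, 0 < d /\ forall t, a <= t <= b -> d <= dist1 p (g t).
Proof.
move=> cg ab off.
have [m [mP mab]] := continuity_ab_min (fun t => dist1 p (g t)) _ _ ab
  (fun t _ => dist1_continuity p cg t).
exists (dist1 p (g m)); split=> //.
case: (dist1_ge0 p (g m)) => // /esym/dist1_eq0 pm.
by case: (off m mab).
Qed.

(** The minimum over two parameters is taken in two stages: the distance [D p] from [p] to the curve
    [h] is 1-Lipschitz in [p], hence continuous along [g], where it attains a minimum that is not
    0. *)
Lemma curves_separation g h a b : curve g -> curve h -> a <= b ->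
  (forall s t, a <= s <= b -> a <= t <= b -> g s <> h t) ->
  exists d, 0 < d /\ forall s t, a <= s <= b -> a <= t <= b -> d <= dist1 (g s) (h t).
Proof.
move=> cg ch ab off.
have /choice[m mP] : forall p, exists m,
    (forall t, a <= t <= b -> dist1 p (h m) <= dist1 p (h t)) /\ a <= m <= b.
  by move=> p; apply: (continuity_ab_min (fun t => dist1 p (h t))) => // t _; apply: dist1_continuity.
pose D p := dist1 p (h (m p)).
have lipD p q : D p <= D q + dist1 p q.
  have [mp _] := mP p; have [_ mq] := mP q.
  have := mp _ mq; have := dist1_triangle q p (h (m q)); rewrite /D; lra.
have cD : forall s, a <= s <= b -> continuity_pt (fun s => D (g s)) s.
  move=> s0 _ eps e0; have [d [d0 dP]] := curve_near s0 cg e0.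
  exists d; split=> // s [_ /= lt].
  rewrite /R_dist in lt *; have := dP s lt.
  have := lipD (g s) (g s0); have := lipD (g s0) (g s); rewrite [dist1 (g s0) _]dist1_sym.
  by move=> h1 h2 h3; apply: Rabs_def1; lra.
have [s0 [s0P s0ab]] := continuity_ab_min _ _ _ ab cD.
exists (D (g s0)); split.
  case: (dist1_ge0 (g s0) (h (m (g s0)))) => // /esym/dist1_eq0 e.
  by have [_ mm] := mP (g s0); case: (off _ _ s0ab mm).
move=> s t sab tab; have := s0P s sab; have [/(_ t tab)] := mP (g s); rewrite /D; lra.
Qed.

Lemma curve_bounded g a b : curve g -> a <= b ->
  exists B, forall t, a <= t <= b -> Rabs (g t).1 <= B /\ Rabs (g t).2 <= B.
Proof.
move=> cg ab.
have [m [mP mab]] := continuity_ab_maj (fun t => dist1 (0, 0) (g t)) _ _ ab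
  (fun t _ => dist1_continuity _ cg t).
exists (dist1 (0, 0) (g m)) => t tab; have := mP t tab; rewrite {1}/dist1 /= !Rminus_0_l !Rabs_Ropp.
have := Rabs_pos (g t).1; have := Rabs_pos (g t).2; lra.
Qed.

Lemma curve_uniform g eps : curve g -> 0 < eps ->
  exists d, 0 < d /\ forall s t, 0 <= s <= 1 -> 0 <= t <= 1 -> Rabs (s - t) < d ->
    Rabs ((g s).1 - (g t).1) < eps /\ Rabs ((g s).2 - (g t).2) < eps.
Proof.
move=> [c1 c2] e0.
have [d1 h1] := Heine _ _ (compact_P3 0 1) (fun x _ => c1 x) (mkposreal eps e0).
have [d2 h2] := Heine _ _ (compact_P3 0 1) (fun x _ => c2 x) (mkposreal eps e0).
exists (Rmin d1 d2); split; first by apply: Rmin_glb_lt; apply: cond_pos.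
move=> s t s01 t01 lt; split.
  by apply: h1 => //; apply: Rlt_le_trans lt (Rmin_l _ _).
by apply: h2 => //; apply: Rlt_le_trans lt (Rmin_r _ _).
Qed.

Definition nfloor (x : R) : nat := Z.to_nat (Int_part x).

Lemma nfloor_itv x : 0 <= x -> INR (nfloor x) <= x < INR (nfloor x) + 1.
Proof.
move=> x0; have [h1 h2] := base_Int_part x.
have z0 : (0 <= Int_part x)%Z by apply/Z.lt_succ_r/lt_IZR; rewrite succ_IZR; lra.
by rewrite /nfloor INR_IZR_INZ Z2Nat.id //; lra.
Qed.
End Distance.

Lemma cconn_mono (C D : pred (nat * nat)) p q : subpred C D -> cconn C p q -> cconn D p q.
Proof.
move=> CD; elim=> [Cp|q' r _ IH Cr a]; first by apply/cconn_refl/CD.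
by apply: cconn_step IH (CD _ Cr) a.
Qed.

Lemma cconn_trans C p q r : cconn C p q -> cconn C q r -> cconn C p r.
Proof. by move=> pq; elim=> // q' s _ IH Cs a; apply: cconn_step IH Cs a. Qed.

Lemma adj4_sym p q : adj4 p q = adj4 q p.
Proof. by rewrite /adj4 ![(p.1 == _) || _]orbC ![(p.2 == _) || _]orbC ![p.1 == q.1]eq_sym ![p.2 == q.2]eq_sym. Qed.

Lemma cconn_sym C p q : cconn C p q -> cconn C q p.
Proof.
elim=> [Cp|q' r pq IH Cr a]; first exact: cconn_refl.
have [_ Cq] := cconn_in pq.
by apply: cconn_trans IH; apply: cconn_step (cconn_refl Cr) Cq _; rewrite adj4_sym.
Qed.

Lemma cconn_component C p q : cconn C p q -> cconn [pred x | `[< cconn C p x >]] p q.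
Proof.
elim=> [Cp|q' r pq IH Cr a]; first by apply/cconn_refl/asboolP/cconn_refl.
by apply: (cconn_step IH _ a); apply/asboolP; apply: cconn_step pq Cr a.
Qed.

Lemma cconn_last_exit (C B : pred (nat * nat)) p q : cconn C p q -> B p -> ~~ B q ->
  exists a b, [/\ B a, adj4 a b & cconn (predD C B) b q].
Proof.
elim=> [_ Bp /negP//|q' r pq IH Cr aqr Bp nBr].
have Dr : predD C B r by rewrite /= nBr.
have [Bq|nBq] := boolP (B q'); first by exists q', r; split=> //; apply: cconn_refl.
have [a [b [Ba ab bq]]] := IH Bp nBq.
by exists a, b; split=> //; apply: cconn_step bq Dr aqr.
Qed.

(** * Lattice paths following a curve *)

Section Lattice.
Local Open Scope R_scope.

Definition box (c : R * R) (rho : R) : pred (nat * nat) :=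
  [pred p | `[< Rabs (INR p.1 - c.1) <= rho /\ Rabs (INR p.2 - c.2) <= rho >]].

Lemma Rabs_leP x a : Rabs x <= a <-> - a <= x <= a.
Proof.
split=> [h|[h1 h2]]; last exact: Rabs_le.
have := Rle_abs x; have := Rle_abs (- x); rewrite Rabs_Ropp; lra.
Qed.

Lemma convex_abs a i j k rho : (i <= k <= j)%N ->
  Rabs (INR i - a) <= rho -> Rabs (INR j - a) <= rho -> Rabs (INR k - a) <= rho.
Proof.
move=> /andP[/leP/le_INR ik /leP/le_INR kj] /Rabs_leP h1 /Rabs_leP h2.
by apply/Rabs_leP; lra.
Qed.

Lemma box_conn c rho p q : box c rho p -> box c rho q -> cconn (box c rho) p q.
Proof.
have H1 i j l : (i <= j)%N -> box c rho (i, l) -> box c rho (j, l) ->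
    cconn (box c rho) (i, l) (j, l).
  move=> le_ij /asboolP[/= hi hl] /asboolP[/= hj _].
  have [n nE] : exists n, j = (i + n)%N by exists (j - i)%N; rewrite subnKC.
  have inb k : (k <= n)%N -> box c rho ((i + k)%N, l).
    move=> kn; apply/asboolP; split=> //=; apply: convex_abs hi hj.
    by rewrite leq_addr nE leq_add2l.
  rewrite nE; elim: {-2}n (leqnn n) => [|k IH] kn.
    by have := inb 0%N kn; rewrite addn0; apply: cconn_refl.
  by apply: cconn_step (IH (ltnW kn)) (inb _ kn) _; rewrite /adj4 /= addnS !eqxx !orbT.
have H2 i j l : (i <= j)%N -> box c rho (l, i) -> box c rho (l, j) ->
    cconn (box c rho) (l, i) (l, j).
  move=> le_ij /asboolP[/= hl hi] /asboolP[/= _ hj].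
  have [n nE] : exists n, j = (i + n)%N by exists (j - i)%N; rewrite subnKC.
  have inb k : (k <= n)%N -> box c rho (l, (i + k)%N).
    move=> kn; apply/asboolP; split=> //=; apply: convex_abs hi hj.
    by rewrite leq_addr nE leq_add2l.
  rewrite nE; elim: {-2}n (leqnn n) => [|k IH] kn.
    by have := inb 0%N kn; rewrite addn0; apply: cconn_refl.
  by apply: cconn_step (IH (ltnW kn)) (inb _ kn) _; rewrite /adj4 /= addnS !eqxx !orbT.
case: p q => [i j] [k l] Bp Bq.
have Bm : box c rho (k, j).
  by move: Bp Bq => /asboolP[/= _ h] /asboolP[/= h' _]; apply/asboolP.
apply: (@cconn_trans _ _ (k, j)).
  case/orP: (leq_total i k) => le; first exact: H1.
  by apply/cconn_sym/H1.
case/orP: (leq_total j l) => le; first exact: H2.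
by apply/cconn_sym/H2.
Qed.

Definition near (g : R -> R * R) (a b : R) : pred (nat * nat) :=
  [pred p | `[< exists t, a <= t <= b /\ box (g t) 2 p >]].

(** By uniform continuity the curve can be sampled so that consecutive points differ by less than 1
    in each coordinate. Rounded down, both lie in the box of radius 2 around the first one, and
    boxes are connected. *)
Lemma curve_lattice g a b : curve g -> a <= b -> 0 <= a -> b <= 1 ->
  (forall t, a <= t <= b -> 0 <= (g t).1 /\ 0 <= (g t).2) ->
  cconn (near g a b) (nfloor (g a).1, nfloor (g a).2) (nfloor (g b).1, nfloor (g b).2).
Proof.
move=> cg ab a0 b1 pos; pose cell t := (nfloor (g t).1, nfloor (g t).2).
have [d [d0 dP]] := curve_uniform cg Rlt_0_1.
have step s t : a <= s <= b -> a <= t <= b -> Rabs (s - t) < d ->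
    cconn (near g a b) (cell s) (cell t).
  move=> sab tab lt; have [h1 h2] := dP s t (conj (Rle_trans _ _ _ a0 sab.1) (Rle_trans _ _ _ sab.2 b1))
    (conj (Rle_trans _ _ _ a0 tab.1) (Rle_trans _ _ _ tab.2 b1)) lt.
  have [s1 s2] := pos s sab; have [t1 t2] := pos t tab.
  apply: (@cconn_mono (box (g s) 2)) => [p bp|]; first by apply/asboolP; exists s.
  have [a1 a2] := Rabs_def2 _ _ h1; have [a3 a4] := Rabs_def2 _ _ h2.
  have i1 := nfloor_itv s1; have i2 := nfloor_itv s2.
  have i3 := nfloor_itv t1; have i4 := nfloor_itv t2.
  by apply: box_conn; apply/asboolP; split; apply/Rabs_leP; rewrite /cell /=; lra.
have [K Kd] := INR_unbounded (/ d).
have K0 : 0 < INR K by apply: Rlt_trans Kd; apply: Rinv_0_lt_compat.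
have Kd1 : / INR K < d.
  by rewrite -[d]Rinv_inv; apply: Rinv_lt_contravar => //; apply: Rmult_lt_0_compat => //; apply: Rinv_0_lt_compat.
have iK0 : 0 < / INR K by apply: Rinv_0_lt_compat.
pose tm k := a + (b - a) * (INR k * / INR K).
have tmab k : (k <= K)%N -> a <= tm k <= b.
  move=> /leP/le_INR kK; rewrite /tm.
  have h1 : 0 <= INR k * / INR K by apply: Rmult_le_pos; [apply: pos_INR|lra].
  have h2 : INR k * / INR K <= 1.
    by rewrite -(Rinv_r (INR K)); [apply: Rmult_le_compat_r; lra|lra].
  by split; nra.
have path k : (k <= K)%N -> cconn (near g a b) (cell (tm 0%N)) (cell (tm k)).
  elim: k => [|k IH] kK; first by apply: step; rewrite ?Rminus_diag ?Rabs_R0 //; apply: tmab.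
  apply: cconn_trans (IH (ltnW kK)) _; apply: step; [exact/tmab/ltnW|exact: tmab|].
  rewrite /tm S_INR Rabs_minus_sym Rabs_right; last by nra.
  by nra.
have := path K (leqnn K).
have -> : tm 0%N = a by rewrite /tm /=; ring.
by have -> : tm K = b by rewrite /tm Rinv_r ?Rmult_1_r; [ring|lra].
Qed.
End Lattice.

Lemma fin_large (I : finType) (P : I -> R -> Prop) :
  (forall i b b', Rle b b' -> P i b -> P i b') ->
  (forall i, exists b, P i b) -> exists b, forall i, P i b.
Proof.
move=> mono exP.
have [||d [d0 dP]] := @fin_small I (fun i d => P i (Rinv d)).
- by move=> i d d' d0 dd; apply: mono; apply: Rinv_le_contravar.
- move=> i; have [b Pb] := exP i; have h : Rlt R0 (Rmax b R1).
    by apply: Rlt_le_trans Rlt_0_1 (Rmax_r _ _).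
  exists (Rinv (Rmax b R1)); split; first exact: Rinv_0_lt_compat.
  by rewrite Rinv_inv; apply: mono Pb; apply: Rmax_l.
by exists (Rinv d).
Qed.

Section Embedding.
Local Open Scope R_scope.

Lemma box_dist1 c rho p : box c rho p -> dist1 c (INR p.1, INR p.2) <= 2 * rho.
Proof.
move/asboolP => [h1 h2]; rewrite /dist1 /= Rabs_minus_sym.
by rewrite [X in _ + X]Rabs_minus_sym; lra.
Qed.

Lemma boxes_dist1 c d rho tau p : box c rho p -> box d tau p ->
  dist1 c d <= 2 * rho + 2 * tau.
Proof.
move=> /box_dist1 h1 /box_dist1; rewrite dist1_sym => h2.
have := dist1_triangle (INR p.1, INR p.2) c d; lra.
Qed.

Definition rescale (n b : R) (p : R * R) : R * R := (n * (p.1 + b), n * (p.2 + b)).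

Lemma dist1_rescale n b p q : 0 <= n -> dist1 (rescale n b p) (rescale n b q) = n * dist1 p q.
Proof.
move=> n0; rewrite /dist1 /=.
have -> : n * (p.1 + b) - n * (q.1 + b) = n * (p.1 - q.1) by ring.
have -> : n * (p.2 + b) - n * (q.2 + b) = n * (p.2 - q.2) by ring.
by rewrite !Rabs_mult (Rabs_right n); [ring|lra].
Qed.

Lemma curve_rescale n b g : curve g -> curve (fun t => rescale n b (g t)).
Proof.
move=> [c1 c2]; split.
  apply: (continuity_scal (fun t => (g t).1 + b)); apply: continuity_plus => //.
  exact: continuity_const.
apply: (continuity_scal (fun t => (g t).2 + b)); apply: continuity_plus => //.
exact: continuity_const.
Qed.

Lemma nfloor_box p c rho : 0 <= p.1 -> 0 <= p.2 -> dist1 p c + 1 <= rho ->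
  box c rho (nfloor p.1, nfloor p.2).
Proof.
move=> /nfloor_itv h1 /nfloor_itv h2; rewrite /dist1 => le.
have := Rle_abs (p.1 - c.1); have := Rle_abs (- (p.1 - c.1)).
have := Rle_abs (p.2 - c.2); have := Rle_abs (- (p.2 - c.2)).
rewrite !Rabs_Ropp; have := Rabs_pos (p.1 - c.1); have := Rabs_pos (p.2 - c.2).
move=> g1 g2 g3 g4 g5 g6.
by apply/asboolP; split; apply/Rabs_leP => /=; lra.
Qed.

Section GridModel.
Variables (T E : finType) (src tgt : E -> T) (pos : T -> R * R) (arc : E -> R -> R * R).
Hypothesis pos_inj : injective pos.
Hypothesis arc_curve : forall e, curve (arc e).
Hypothesis arc_src : forall e, arc e 0 = pos (src e).
Hypothesis arc_tgt : forall e, arc e 1 = pos (tgt e).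
Hypothesis arc_pos : forall e z t, 0 < t < 1 -> arc e t <> pos z.
Hypothesis arc_arc : forall e f s t, e <> f -> 0 < s < 1 -> 0 < t < 1 -> arc e s <> arc f t.

Lemma vertex_separation : exists d, 0 < d /\
  (forall x y, x <> y -> d <= dist1 (pos x) (pos y)) /\
  (forall e z, z <> src e -> z <> tgt e -> forall t, 0 <= t <= 1 -> d <= dist1 (pos z) (arc e t)).
Proof.
have [||d1 [d1p d1P]] := @fin_small (T * T)%type
  (fun p d => p.1 <> p.2 -> d <= dist1 (pos p.1) (pos p.2)).
- by move=> i d d' d0 dd h /h; lra.
- move=> [x y] /=; have [->|ne] := pselect (x = y); first by exists 1; split; [lra|].
  exists (dist1 (pos x) (pos y)); split; last by move=> _; lra.
  by case: (dist1_ge0 (pos x) (pos y)) => // /esym/dist1_eq0/pos_inj.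
have [||d2 [d2p d2P]] := @fin_small (E * T)%type
  (fun p d => p.2 <> src p.1 -> p.2 <> tgt p.1 ->
     forall t, 0 <= t <= 1 -> d <= dist1 (pos p.2) (arc p.1 t)).
- by move=> i d d' d0 dd h n1 n2 t tt; have := h n1 n2 t tt; lra.
- move=> [e z] /=; have [zs|zs] := pselect (z = src e); first by exists 1; split; [lra|].
  have [zt|zt] := pselect (z = tgt e); first by exists 1; split; [lra|].
  have [|t t01|d [d0 dP]] := @curve_point_separation (arc e) (pos z) 0 1 (arc_curve e).
  + lra.
  + have [->|t0] := pselect (t = 0); first by rewrite arc_src => /pos_inj/esym.
    have [->|t1] := pselect (t = 1); first by rewrite arc_tgt => /pos_inj/esym.
    by apply: arc_pos; lra.
  by exists d.
exists (Rmin d1 d2); split; first exact: Rmin_glb_lt.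
split=> [x y ne|e z n1 n2 t t01].
  by apply: Rle_trans (Rmin_l _ _) (d1P (x, y) ne).
by apply: Rle_trans (Rmin_r _ _) (d2P (e, z) n1 n2 t t01).
Qed.

Lemma end_proximity r : 0 < r -> exists h, 0 < h < / 2 /\
  forall e, dist1 (arc e h) (pos (src e)) < r /\ dist1 (arc e (1 - h)) (pos (tgt e)) < r.
Proof.
move=> r0; have [||h [h0 hP]] := @fin_small E (fun e h => forall t, 0 <= t <= h ->
  dist1 (arc e t) (pos (src e)) < r /\ dist1 (arc e (1 - t)) (pos (tgt e)) < r).
- by move=> e d d' d0 dd h t tt; apply: h; lra.
- move=> e; have [d1 [d10 d1P]] := curve_near 0 (arc_curve e) r0.
  have [d2 [d20 d2P]] := curve_near 1 (arc_curve e) r0.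
  have m1 := Rmin_l d1 d2; have m2 := Rmin_r d1 d2; have m0 := Rmin_glb_lt _ _ _ d10 d20.
  exists (Rmin d1 d2 / 2); split; first by lra.
  move=> t tt; rewrite -arc_src -arc_tgt; split.
    by apply: d1P; rewrite Rminus_0_r Rabs_right; lra.
  apply: d2P; have -> : 1 - t - 1 = - t by ring.
  by rewrite Rabs_Ropp Rabs_right; lra.
have m1 := Rmin_l h (/ 4); have m2 := Rmin_r h (/ 4).
have m0 : 0 < Rmin h (/ 4) by apply: Rmin_glb_lt; lra.
exists (Rmin h (/ 4)); split; first by lra.
by move=> e; apply: hP; lra.
Qed.

(** Arcs with a common end come arbitrarily close to each other, so only their middle parts can be
    separated; the end parts are absorbed by the boxes of the vertices. *)
Lemma arc_separation h : 0 < h < / 2 -> exists d, 0 < d /\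
  forall e f s t, e <> f -> h <= s <= 1 - h -> h <= t <= 1 - h -> d <= dist1 (arc e s) (arc f t).
Proof.
move=> h0; have [||d [d0 dP]] := @fin_small (E * E)%type (fun p d => p.1 <> p.2 ->
  forall s t, h <= s <= 1 - h -> h <= t <= 1 - h -> d <= dist1 (arc p.1 s) (arc p.2 t)).
- by move=> i d d' d0 dd H ne s t ss tt; have := H ne s t ss tt; lra.
- move=> [e f] /=; have [ef|ne] := pselect (e = f); first by exists 1; split; [lra|].
  have [|s t ss tt|d [d0 dP]] := @curves_separation (arc e) (arc f) h (1 - h) (arc_curve e) (arc_curve f).
  + lra.
  + by apply: arc_arc => //; lra.
  by exists d.
by exists d; split=> // e f s t ne; apply: (dP (e, f)).
Qed.

Lemma arcs_bounded : exists b, 0 <= b /\ 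
  (forall v, Rabs (pos v).1 <= b /\ Rabs (pos v).2 <= b) /\
  (forall e t, 0 <= t <= 1 -> Rabs (arc e t).1 <= b /\ Rabs (arc e t).2 <= b).
Proof.
have [||b1 b1P] := @fin_large T (fun v b => Rabs (pos v).1 <= b /\ Rabs (pos v).2 <= b).
- by move=> v b b' bb [? ?]; lra.
- by move=> v; exists (Rmax (Rabs (pos v).1) (Rabs (pos v).2)); split; [apply: Rmax_l|apply: Rmax_r].
have [||b2 b2P] := @fin_large E (fun e b => forall t, 0 <= t <= 1 ->
  Rabs (arc e t).1 <= b /\ Rabs (arc e t).2 <= b).
- by move=> e b b' bb H t tt; have := H t tt; lra.
- by move=> e; apply: curve_bounded => //; lra.
have m1 := Rmax_l 0 (Rmax b1 b2); have m2 := Rmax_r 0 (Rmax b1 b2).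
have m3 := Rmax_l b1 b2; have m4 := Rmax_r b1 b2.
exists (Rmax 0 (Rmax b1 b2)); split=> //; split=> [v|e t tt].
  by have := b1P v; lra.
by have := b2P e t tt; lra.
Qed.

(* Each branch set is a lattice box around the image of the vertex, enlarged by
   the final part, after its last exit from the box of the source, of a lattice
   path following each arc that ends at the vertex. *)
Lemma embedding_grid : exists (N : nat) (cls : T -> pred (nat * nat)),
  [/\ forall v w p, cls v p -> cls w p -> v = w,
      forall v p, cls v p -> [&& 0 < p.1, p.1 < N, 0 < p.2 & p.2 < N]%N,
      forall v p q, cls v p -> cls v q -> cconn (cls v) p q &
      forall e, src e != tgt e ->
        exists p q, [/\ cls (src e) p, cls (tgt e) q & adj4 p q]].
Proof.
have [d1 [d1p [vv va]]] := vertex_separation.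
(* Two boxes of radius [n * r] that meet have centres at distance at most [4 * (n * r)], and a box
   meeting the lattice path of an arc is within [2 * (n * r) + 4] of it; both are less than
   [n * d1]. *)
pose r := d1 / 8; have r0 : 0 < r by rewrite /r; lra.
have [h [hb hP]] := end_proximity (r := r / 2) ltac:(lra).
have [d3 [d3p aa]] := arc_separation hb.
have [b0 [b00 [bv ba]]] := arcs_bounded.
(* This shift makes all scaled coordinates at least [n * r + 3], so that every box consists of
   points with positive coordinates. *)
pose b := b0 + r + 3.
(* From [n * r > 2], the rounded ends of the shortened arcs fall in the boxes of their vertices;
   from [n * d3 > 8], the neighbourhoods of radius 2 of distinct arcs are disjoint. *)
have [n0 n0P] := INR_unbounded (1 + 2 / r + 9 / d3).
set n := INR n0 in n0P.
have q1 : 0 < 2 / r by apply: Rdiv_lt_0_compat; lra.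
have q2 : 0 < 9 / d3 by apply: Rdiv_lt_0_compat; lra.
have n1 : 1 < n by lra.
have nr2 : 2 < n * r.
  have : 2 / r * r < n * r by apply: Rmult_lt_compat_r; lra.
  by rewrite /Rdiv Rmult_assoc Rinv_l; lra.
have nd8 : 8 < n * d3.
  have : 9 / d3 * d3 < n * d3 by apply: Rmult_lt_compat_r; lra.
  by rewrite /Rdiv Rmult_assoc Rinv_l; lra.
have [M MP] := INR_unbounded (n * (b0 + b) + n * r + 2).
have nd1 : n * d1 = 8 * (n * r) by rewrite /r; field.
pose sc := rescale n b; have sc0 : 0 <= n by lra.
have coord x : Rabs x <= b0 -> n * r + 3 <= n * (x + b) <= n * (b0 + b).
  move/Rabs_leP => [x1 x2]; have h1 : r + 3 <= x + b by rewrite /b; lra.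
  have := Rmult_le_compat_l n _ _ sc0 h1.
  have h2 : x + b <= b0 + b by lra.
  have := Rmult_le_compat_l n _ _ sc0 h2.
  by rewrite Rmult_plus_distr_l; lra.
pose B v := box (sc (pos v)) (n * r).
pose nr e := near (fun t => sc (arc e t)) h (1 - h).
have h01 t : h <= t <= 1 - h -> 0 <= t <= 1 by lra.
have BB v w p : B v p -> B w p -> v = w.
  move=> Bv Bw; have [//|ne] := pselect (v = w).
  have := boxes_dist1 Bv Bw; rewrite dist1_rescale //.
  by have := Rmult_le_compat_l n _ _ sc0 (vv _ _ ne); lra.
have Bnr v e p : B v p -> nr e p -> v = src e \/ v = tgt e.
  move=> Bv /asboolP[t [tt bt]].
  have [vs|ns] := pselect (v = src e); first by left.
  have [vt|nt] := pselect (v = tgt e); first by right.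
  have := boxes_dist1 Bv bt; rewrite dist1_rescale //.
  by have := Rmult_le_compat_l n _ _ sc0 (va _ _ ns nt t (h01 t tt)); lra.
have nrnr e f p : nr e p -> nr f p -> e = f.
  move=> /asboolP[s [ss bs]] /asboolP[t [tt bt]].
  have [//|ne] := pselect (e = f).
  have := boxes_dist1 bs bt; rewrite dist1_rescale //.
  by have := Rmult_le_compat_l n _ _ sc0 (aa _ _ s t ne ss tt); lra.
have inside c rho p : n * r + 3 <= c.1 <= n * (b0 + b) -> n * r + 3 <= c.2 <= n * (b0 + b) ->
    rho <= n * r -> box c rho p -> [&& 0 < p.1, p.1 < M, 0 < p.2 & p.2 < M]%N.
  move=> c1 c2 rr /asboolP[/Rabs_leP h1 /Rabs_leP h2].
  by apply/and4P; split; apply/ltP/INR_lt; rewrite ?[INR 0]/=; lra.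
have B_in v p : B v p -> [&& 0 < p.1, p.1 < M, 0 < p.2 & p.2 < M]%N.
  by apply: inside; rewrite /=; try lra; apply: coord; case: (bv v).
have nr_in e p : nr e p -> [&& 0 < p.1, p.1 < M, 0 < p.2 & p.2 < M]%N.
  case/asboolP=> t [tt]; have [a1 a2] := ba e t (h01 t tt).
  by apply: inside; rewrite /=; try lra; apply: coord.
(* The last exit of the lattice path of [e] from the box of its source; a loop gets a dummy
   value. *)
have exitP e : exists pq : (nat * nat) * (nat * nat), src e <> tgt e ->
    [/\ B (src e) pq.1, adj4 pq.1 pq.2 &
        exists2 q, B (tgt e) q & cconn (predD (nr e) (B (src e))) pq.2 q].
  have [->|ne] := pselect (src e = tgt e); first by exists ((0, 0), (0, 0))%N.
  have path := @curve_lattice (fun t => sc (arc e t)) h (1 - h) (curve_rescale _ _ (arc_curve e)).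
  have pos_sc t : 0 <= t <= 1 -> 0 <= (sc (arc e t)).1 /\ 0 <= (sc (arc e t)).2.
    by move=> tt; have [/coord a1 /coord a2] := ba e t tt; rewrite /=; lra.
  have {}path := path ltac:(lra) ltac:(lra) ltac:(lra) (fun t tt => pos_sc t (h01 t tt)).
  have [e1 e2] := hP e.
  have [s1 s2] := pos_sc h ltac:(lra).
  have [t1 t2] := pos_sc (1 - h) ltac:(lra).
  have half x : x < r / 2 -> n * x + 1 <= n * r.
    move=> xr; have := Rmult_lt_compat_l n _ _ (Rlt_trans _ _ _ Rlt_0_1 n1) xr.
    by rewrite /Rdiv -Rmult_assoc; lra.
  have Bs : B (src e) (nfloor (sc (arc e h)).1, nfloor (sc (arc e h)).2).
    by apply: nfloor_box => //; rewrite dist1_rescale //; apply: half.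
  have Bt : B (tgt e) (nfloor (sc (arc e (1 - h))).1, nfloor (sc (arc e (1 - h))).2).
    by apply: nfloor_box => //; rewrite dist1_rescale //; apply: half.
  have [|p [q [Bp pq cq]]] := cconn_last_exit path Bs.
    by apply/negP => /BB /(_ Bt).
  by exists (p, q) => _; split=> //; exists (nfloor (sc (arc e (1 - h))).1, nfloor (sc (arc e (1 - h))).2).
have /fin_all_exists[pq pqP] := exitP.
(* The whole component of the tail is taken: disjointness only needs points near the arc and outside
   the source box, and connectedness is then automatic. *)
pose Q e := [pred x | `[< src e <> tgt e /\ cconn (predD (nr e) (B (src e))) (pq e).2 x >]].
have Qnr e p : Q e p -> nr e p /\ ~~ B (src e) p.
  by move/asboolP=> [_ /cconn_in[_ /andP[]]].
have BQ v e p : B v p -> Q e p -> v = tgt e.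
  move=> Bv /Qnr[np nB]; case: (Bnr _ _ _ Bv np) => // vs.
  by rewrite -vs Bv in nB.
pose cls v := [pred p | B v p || [exists e, (tgt e == v) && Q e p]].
have clsP v p : cls v p -> B v p \/ exists2 e, tgt e = v & Q e p.
  by case/orP=> [|/existsP[e /andP[/eqP ev Qp]]]; [left|right; exists e].
have Bcls v p : B v p -> cls v p by move=> Bp; apply/orP; left.
have Qcls e p : Q e p -> cls (tgt e) p.
  by move=> Qp; apply/orP; right; apply/existsP; exists e; rewrite eqxx.
exists M, cls; split.
- move=> v w p /clsP[Bv|[e ev Qe]] /clsP[Bw|[f fw Qf]].
  + exact: BB Bv Bw.
  + by rewrite -fw; apply: BQ Bv Qf.
  + by rewrite -ev; apply/esym; apply: BQ Bw Qe.
  + by have [/nrnr h1 _] := Qnr _ _ Qe; have [/h1 ef _] := Qnr _ _ Qf; rewrite -ev -fw ef.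
- by move=> v p /clsP[/B_in//|[e _ /Qnr[/nr_in]]].
(* Every point of the class is joined to one point [c] of the box. Without such a point the class is
   empty, because each tail [Q e] reaches the box of its target. *)
- move=> v; have [[c Bc]|nB] := pselect (exists c, B v c); last first.
    move=> p q /clsP[Bp|[e ev /asboolP[/pqP[_ _ [c Bc _]] _]]] _; case: nB; first by exists p.
    by exists c; rewrite -ev.
  suff toc p : cls v p -> cconn (cls v) p c.
    by move=> p q /toc cp /toc/cconn_sym; apply: cconn_trans.
  have BBc q : B v q -> cconn (cls v) q c.
    by move=> Bq; apply: cconn_mono (box_conn Bq Bc) => x; apply: Bcls.
  case/clsP=> [/BBc//|[e ev /asboolP[ne Qp]]].
  have [_ _ [q Bq bq]] := pqP e ne.
  have inQ x : cconn (predD (nr e) (B (src e))) (pq e).2 x -> cconn (cls v) (pq e).2 x.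
    move=> bx; apply: cconn_mono (cconn_component bx) => y /asboolP by_.
    by rewrite -ev; apply: Qcls; apply/asboolP.
  apply: cconn_trans (cconn_sym (inQ _ Qp)) _.
  by apply: cconn_trans (inQ _ bq) (BBc _ _); rewrite -ev.
- move=> e /eqP ne; have [Bp ab [q Bq bq]] := pqP e ne.
  exists (pq e).1, (pq e).2; split=> //; first exact: Bcls.
  apply: Qcls; apply/asboolP; split=> //; apply: cconn_refl.
  by have [] := cconn_in bq.
Qed.
End GridModel.
End Embedding.

(** * List edge colourings of bipartite graphs *)

(* Rado's proof: by submodularity of the cardinal, a member of size at least 2
   loses one of any two of its elements without breaking Hall's condition. *)
Lemma hall (I Y : finType) (F : I -> {set Y}) :
  (forall J : {set I}, #|J| <= #|\bigcup_(i in J) F i|) ->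
  exists f : I -> Y, injective f /\ forall i, f i \in F i.
Proof.
have [n] := ubnP (\sum_i #|F i|); elim: n F => // n IH F ltn HF.
have F1 i : 0 < #|F i| by have := HF [set i]; rewrite cards1 big_set1.
have [/existsP[i0 Fi0]|/existsPn Fle1] := boolP [exists i, 1 < #|F i|]; last first.
  have /fin_all_exists[f fP] : forall i, exists y, F i = [set y].
    by move=> i; apply/cards1P; rewrite eqn_leq F1 leqNgt Fle1.
  exists f; split=> [i j fij|i]; last by rewrite fP set11.
  apply/eqP; apply: contraTT (HF [set i; j]) => neq_ij.
  by rewrite cards2 neq_ij bigcup_setU !big_set1 !fP fij setUid cards1.
have [y1 [y2 [Fy1 Fy2 neq_y]]] := card_gt1P Fi0.
pose G y i := if i == i0 then F i :\ y else F i.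
have Gi y i : i != i0 -> G y i = F i by rewrite /G => /negbTE->.
have Gi0 y : G y i0 = F i0 :\ y by rewrite /G eqxx.
have step y : y \in F i0 -> (forall J : {set I}, #|J| <= #|\bigcup_(i in J) G y i|) ->
    exists f : I -> Y, injective f /\ forall i, f i \in F i.
  move=> Fy HG; case: (IH (G y)) => // [|f [inj_f fG]].
    rewrite -ltnS; apply: leq_trans ltn.
    rewrite (bigD1 i0) //= [X in _ < X.+1](bigD1 i0) //= Gi0 [in X in _ < X](cardsD1 y) Fy.
    by rewrite (eq_bigr (fun i => #|F i|)) // => i /Gi->.
  exists f; split=> // i; have := fG i; rewrite /G.
  by case: eqP => // _; rewrite inE => /andP[].
have viol y : ~ (forall J : {set I}, #|J| <= #|\bigcup_(i in J) G y i|) ->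
    exists A : {set I}, i0 \notin A /\ #|(\bigcup_(i in A) F i) :|: (F i0 :\ y)| <= #|A|.
  move=> nG; have [J nJ] : exists J : {set I}, ~ (#|J| <= #|\bigcup_(i in J) G y i|).
    by apply/existsNP.
  have i0J : i0 \in J.
    apply/negPn/negP => ni0; case: nJ.
    rewrite (eq_bigr F) ?HF // => i iJ; apply: Gi.
    by apply: contraNneq ni0 => <-.
  exists (J :\ i0); split; first by rewrite setD11.
  move/negP: nJ; rewrite -ltnNge (cardsD1 i0 J) i0J ltnS; apply: leq_trans.
  apply/subset_leq_card; rewrite [\bigcup_(i in J) _](big_setD1 i0) //= Gi0 setUC setUS //.
  by apply/bigcupsP => i iJ; rewrite -(Gi y) ?bigcup_sup //; case/setD1P: iJ.
have [/(step _ Fy1) //|/viol[A [nA leA]]] := pselect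
  (forall J : {set I}, #|J| <= #|\bigcup_(i in J) G y1 i|).
have [/(step _ Fy2) //|/viol[B [nB leB]]] := pselect
  (forall J : {set I}, #|J| <= #|\bigcup_(i in J) G y2 i|).
have := leq_add leA leB; rewrite leqNgt => /negP[].
rewrite -cardsUI -[X in _ < X]cardsUI.
have leI := HF (A :&: B); have := HF (i0 |: (A :|: B)).
rewrite cardsU1 inE negb_or nA nB add1n => leU.
apply: (leq_trans (leq_add leU leI)); apply: leq_add; apply/subset_leq_card.
  apply/bigcupsP => i; rewrite !inE => /or3P[/eqP->|iA|iB]; apply/subsetP => y Fy; rewrite !inE.
  - by rewrite Fy !andbT; case: (eqVneq y y1) => [->|_]; rewrite ?neq_y ?orbT.
  - by apply/orP; left; apply/orP; left; apply/bigcupP; exists i.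
  - by apply/orP; right; apply/orP; left; apply/bigcupP; exists i.
apply/bigcupsP => i; rewrite inE => /andP[iA iB]; apply/subsetP => y Fy; rewrite !inE.
by apply/andP; split; apply/orP; left; apply/bigcupP; exists i.
Qed.

Section Bipartite.
Variables (E X Y : finType) (fx : E -> X) (fy : E -> Y).
Implicit Types A : {set E}.

Definition dx A x := #|[set e in A | fx e == x]|.
Definition dy A y := #|[set e in A | fy e == y]|.

(** Removing [S] lowers the maximum degree from [j.+1] to [j] on both sides, while each vertex of
    [Y] loses at most one edge. Hall's condition holds for the full vertices of [X]: each emits
    [j.+1] edges, and no vertex of [Y] receives more. *)
Lemma select_edges j A : (forall x, dx A x <= j.+1) -> (forall y, dy A y <= j.+1) ->
  (forall e, e \in A -> dx A (fx e) = j.+1 -> dy A (fy e) = j.+1) ->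
  exists S : {set E}, [/\ S \subset A,
    forall e, e \in S -> dy A (fy e) = j.+1,
    {in S &, injective fy},
    forall y, dy A y = j.+1 -> exists2 e, e \in S & fy e = y &
    forall x, dx A x = j.+1 -> exists2 e, e \in S & fx e = x].
Proof.
move=> lex ley full.
pose Xt := {x : X | dx A x == j.+1}.
pose F (x : Xt) : {set Y} := [set fy e | e in [set e in A | fx e == val x]].
have HF (J : {set Xt}) : #|J| <= #|\bigcup_(x in J) F x|.
  rewrite -(leq_pmul2r (ltn0Sn j)) -!sum_nat_const.
  apply: (@leq_trans (\sum_(x in J) #|[set e in A | fx e == val x]|)).
    by apply: leq_sum => -[x /= /eqP dxx] _; rewrite -dxx.
  apply: (@leq_trans (\sum_(y in \bigcup_(x in J) F x) dy A y)); last first.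
    by apply: leq_sum => y _; apply: ley.
  rewrite (eq_bigr (fun x : Xt => \sum_(e in A) (fx e == val x))); last first.
    move=> x _; rewrite -sum1_card big_mkcond [RHS]big_mkcond; apply: eq_bigr => e _.
    by rewrite inE; case: (e \in A); case: (_ == _).
  rewrite [X in _ <= X](eq_bigr (fun y => \sum_(e in A) (fy e == y))); last first.
    move=> x _; rewrite /dy -sum1_card big_mkcond [RHS]big_mkcond; apply: eq_bigr => e _.
    by rewrite inE; case: (e \in A); case: (_ == _).
  rewrite exchange_big [X in _ <= X]exchange_big; apply: leq_sum => e Ae /=.
  case: (pickP (fun x : Xt => (x \in J) && (fx e == val x))) => [x /andP[Jx ex]|nx].
    rewrite (bigD1 x) //= ex big1 => [|x' /andP[_ nx']]; last first.
      by rewrite (eqP ex) (inj_eq val_inj) eq_sym (negbTE nx').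
    rewrite (bigD1 (fy e)) /= ?eqxx //; apply/bigcupP; exists x => //.
    by apply/imsetP; exists e; rewrite // inE Ae.
  by rewrite big1 // => x Jx; have := nx x; rewrite Jx /= => ->.
have [f [inj_f fF]] := hall HF.
have /fin_all_exists[m mP] : forall x : Xt, exists e, [/\ e \in A, fx e = val x & fy e = f x].
  move=> x; have /imsetP[e] := fF x; rewrite inE => /andP[Ae /eqP ex] fe.
  by exists e.
pose good e := [exists x, m x == e].
(* A full [y] keeps its edge from Hall's theorem if it has one, which is unique as [f] is injective,
   and any edge otherwise. *)
pose sel y := if [pick e | [&& e \in A, fy e == y & good e]] is Some e then Some e
              else [pick e | (e \in A) && (fy e == y)].
have selA y e : sel y = Some e -> e \in A /\ fy e = y.
  rewrite /sel; case: pickP => [e' /and3P[Ae /eqP fe _] [<-] //|_].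
  by case: pickP => [e' /andP[Ae /eqP fe] [<-] //|].
exists [set e in A | (dy A (fy e) == j.+1) && (sel (fy e) == Some e)]; split.
- by apply/subsetP => e; rewrite inE => /andP[].
- by move=> e; rewrite !inE => /and3P[_ /eqP].
- move=> e e'; rewrite !inE => /and3P[_ _ /eqP s1] /and3P[_ _ /eqP s2] ee.
  by move: s1; rewrite ee s2 => -[].
- move=> y dyy; case sy : (sel y) => [e|].
    by have [Ae fe] := selA _ _ sy; exists e => //; rewrite inE Ae fe dyy sy !eqxx.
  have : 0 < dy A y by rewrite dyy.
  case/card_gt0P => e; rewrite inE => ey; move: sy; rewrite /sel.
  by case: pickP => // _; case: pickP => // /(_ e); rewrite ey.
- move=> x dxx; have dx' : dx A x == j.+1 by apply/eqP.
  pose x' : Xt := exist _ x dx'; have [Am fxm fym] := mP x'.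
  exists (m x') => //; rewrite inE Am full //= ?fxm // eqxx /=.
  rewrite /sel; case: pickP => [e' /and3P[_ fe /existsP[x2 /eqP e'E]]|/(_ (m x'))].
    rewrite -e'E; have [_ _ fy2] := mP x2.
    by have /inj_f<- : f x' = f x2; first by rewrite -fym -fy2 e'E (eqP fe).
  by rewrite Am eqxx /= => /negbT/negP[]; apply/existsP; exists x'.
Qed.

(* The ranks at [y] will be [0, ..., dy A y - 1], while an [x] sees at most
   [t + 1] ranks that are at most [t]: preferring large ranks at [y] and small ones at [x],
   every edge has fewer than [dy A (fy e)] better ones. *)
Lemma edge_ranks i j A : (forall x, dx A x <= minn i j) ->
  (forall e, e \in A -> minn i j <= dy A (fy e)) -> (forall y, dy A y <= j) ->
  exists r : E -> nat,
  [/\ forall e, e \in A -> r e < dy A (fy e),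
      {in A &, forall e e', fy e = fy e' -> r e = r e' -> e = e'} &
      forall x t, #|[set e in A | (fx e == x) && (r e <= t)]| <= t.+1].
Proof.
elim: j A => [|j IH] A lex gey ley.
  have A0 e : e \in A = false.
    apply/negbTE/negP => Ae; have := ley (fy e); rewrite leqn0 cards_eq0.
    by move/eqP/setP/(_ e); rewrite !inE Ae eqxx.
  exists (fun _ => 0); split=> [e|e e'|x t]; rewrite ?A0 //.
  by rewrite (_ : [set _ in _ | _] = set0) ?cards0 //; apply/setP => e; rewrite !inE A0.
have [||S [SA Sfull Sinj Sy Sx]] := @select_edges j A _ ley.
- by move=> x; apply: leq_trans (lex x) (geq_minr _ _).
- move=> e Ae dxe; apply/eqP; rewrite eqn_leq ley /=; apply: leq_trans (gey e Ae).
  by have := lex (fx e); rewrite dxe.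
have cardD (P : pred E) :
    #|[set e in A | P e]| = #|[set e in A :\: S | P e]| + #|[set e in S | P e]|.
  rewrite -cardsUI (_ : _ :&: _ = set0) ?cards0 ?addn0.
    apply: eq_card => e; rewrite !inE -andb_orl; congr (_ && _).
    by case: (boolP (e \in S)) => [/(subsetP SA)|] /=; rewrite ?orbF ?orbT.
  by apply/setP => e; rewrite !inE; case: (e \in S); rewrite //= andbF.
have dyD y : dy A y = dy (A :\: S) y + dy S y := cardD _.
have dxD x : dx A x = dx (A :\: S) x + dx S x := cardD _.
have dyS y : dy A y = j.+1 -> dy S y = 1.
  move=> /Sy[e Se ey]; apply/eqP/cards1P; exists e; apply/setP => e'; rewrite !inE.
  apply/andP/eqP => [[Se' /eqP e'y]|->]; last by rewrite ey.
  by apply: Sinj; rewrite ?e'y.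
have dyS0 y : dy A y != j.+1 -> dy S y = 0.
  move=> ny; apply/eqP; rewrite cards_eq0; apply/eqP/setP => e; rewrite !inE.
  by apply/negbTE; apply: contra ny => /andP[Se /eqP<-]; rewrite Sfull.
have dyA' y : dy A y = j.+1 -> dy (A :\: S) y = j.
  by move=> h; have := dyD y; rewrite h dyS // addn1 => -[].
have [|||r [rlt rinj rcnt]] := IH (A :\: S).
- move=> x; have := lex x; rewrite dxD !leq_min => /andP[h1 h2].
  rewrite (leq_trans (leq_addr _ _) h1) /=.
  have [xf|xnf] := eqVneq (dx A x) j.+1; last first.
    rewrite -ltnS; apply: leq_ltn_trans (leq_addr (dx S x) _) _.
    by rewrite -dxD ltn_neqAle xnf dxD.
  have [e Se ex] := Sx x xf.
  have pos : 0 < dx S x by apply/card_gt0P; exists e; rewrite inE Se ex eqxx.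
  by rewrite -ltnS; apply: leq_trans h2; rewrite -[X in X < _]addn0 ltn_add2l.
- move=> e /setDP[Ae nSe].
  have [yf|ynf] := eqVneq (dy A (fy e)) j.+1; first by rewrite dyA' // geq_minr.
  have := dyD (fy e); rewrite dyS0 // addn0 => <-.
  by apply: leq_trans (gey e Ae); rewrite leq_min geq_minl (leq_trans (geq_minr i j) (leqnSn j)).
- move=> y; have [yf|ynf] := eqVneq (dy A y) j.+1; first by rewrite dyA'.
  have := dyD y; rewrite dyS0 // addn0 => <-.
  by rewrite -ltnS ltn_neqAle ynf ley.
(* Selected edges get the top rank [j] at their end in [Y]. They do not count among the ranks at
   most [t < j], and for [t >= j] the degree bound [j.+1] suffices. *)
exists (fun e => if e \in S then j else r e); split.
- move=> e Ae; case: ifP => [/Sfull-> //|nS].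
  by apply: leq_trans (rlt e _) _; rewrite ?inE ?nS // dyD leq_addr.
- have aux e e' : e \in S -> e' \in A -> e' \notin S -> fy e = fy e' -> j <> r e'.
    move=> Se Ae' nSe' ee' jr; have := rlt e'; rewrite inE nSe' Ae' => /(_ isT).
    by rewrite -ee' dyA' ?Sfull // -jr ltnn.
  move=> e e' Ae Ae' ee'; case: ifP => [Se|nSe]; case: ifP => [Se'|nSe'].
  + by move=> _; apply: Sinj.
  + by move/(aux e e' Se Ae' (negbT nSe') ee').
  + by move/esym/(aux e' e Se' Ae (negbT nSe) (esym ee')).
  + by apply: rinj; rewrite ?inE ?nSe ?nSe'.
- move=> x t; have [lejt|lttj] := leqP j t.
    apply: leq_trans (_ : dx A x <= _).
      by apply/subset_leq_card/subsetP => e; rewrite !inE => /and3P[-> ->].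
    by apply: leq_trans (lex x) _; apply: leq_trans (geq_minr _ _) _.
  apply: leq_trans (rcnt x t); apply/subset_leq_card/subsetP => e; rewrite !inE.
  by case: ifP => [eS|nS] /and3P[-> ->] /=; rewrite ?(leqNgt j) ?lttj.
Qed.

(** * Stable matchings and Galvin's theorem *)

Section Stable.
Variables px py : E -> nat.
Hypothesis px_inj : forall e e', fx e = fx e' -> px e = px e' -> e = e'.
Hypothesis py_inj : forall e e', fy e = fy e' -> py e = py e' -> e = e'.

Definition better e e' :=
  (fx e' == fx e) && (px e' < px e) || (fy e' == fy e) && (py e' < py e).

(* If the favourite edges of two vertices of [X] collide at some [y], the worse of
   the two can be removed: whatever dominates the better one dominates it too. *)
Lemma stable_matching A :
  exists K : {set E}, [/\ K \subset A, {in K &, injective fx}, {in K &, injective fy} &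
    forall e, e \in A -> e \notin K -> exists2 k, k \in K & better e k].
Proof.
have [n] := ubnP #|A|; elim: n A => // n IH A ltn.
pose fav e := (e \in A) && [forall e' in A, (fx e' == fx e) ==> (px e <= px e')].
have fav_ex e : e \in A -> exists2 f, fav f & fx f = fx e.
  move=> Ae; have Pe : (e \in A) && (fx e == fx e) by rewrite Ae eqxx.
  case: (@arg_minnP _ e (fun e' => (e' \in A) && (fx e' == fx e)) px Pe) => f.
  move=> /andP[Af /eqP fe] minf; exists f => //; rewrite /fav Af.
  apply/forall_inP => e' Ae'; apply/implyP => /eqP ee'; apply: minf.
  by rewrite Ae' ee' fe eqxx.
have fav_inj e e' : fav e -> fav e' -> fx e = fx e' -> e = e'.
  move=> /andP[Ae /forall_inP me] /andP[Ae' /forall_inP me'] ee'.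
  apply: px_inj => //; apply/eqP; rewrite eqn_leq.
  by have := me e' Ae'; have := me' e Ae; rewrite ee' eqxx /= => -> ->.
have [/existsP[e /existsP[e' /and5P[fe fe' ne ee' lt]]]|nex] :=
  boolP [exists e, exists e', [&& fav e, fav e', e != e', fy e == fy e' & py e' < py e]].
  have [Ae _] := andP fe; have [Ae' _] := andP fe'.
  case: (IH (A :\ e)) => [|K [KA Kx Ky Kd]].
    by rewrite -ltnS; apply: leq_trans ltn; rewrite [in X in _ < X](cardsD1 e) Ae.
  exists K; split=> //; first by apply: subset_trans KA (subsetDl _ _).
  move=> g Ag nKg; have [ge|ge] := eqVneq g e; last by apply: Kd; rewrite // !inE ge.
  rewrite {g}ge in Ag nKg *; have [Ke'|nKe'] := boolP (e' \in K).
    by exists e' => //; rewrite /better (eqP ee') eqxx lt orbT.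
  have [|k Kk] := Kd e' _ nKe'; first by rewrite !inE Ae' eq_sym ne.
  have /setD1P[_ Ak] := subsetP KA _ Kk.
  case/orP=> /andP[/eqP ke ltk].
    have /andP[_ /forall_inP/(_ k Ak)] := fe'.
    by rewrite ke eqxx /= leqNgt ltk.
  exists k => //; rewrite /better ke (eqP ee') eqxx (ltn_trans ltk) ?orbT //.
exists [set e | fav e]; split.
- by apply/subsetP => e; rewrite inE => /andP[].
- by move=> e e'; rewrite !inE; apply: fav_inj.
- move=> e e'; rewrite !inE => fe fe' ee'.
  have neg e1 e2 : fav e1 -> fav e2 -> e1 <> e2 -> fy e1 = fy e2 -> ~~ (py e2 < py e1).
    move=> f1 f2 n12 e12; apply: contraNN nex => lt; apply/existsP; exists e1.
    by apply/existsP; exists e2; rewrite f1 f2 e12 eqxx lt !andbT; apply/eqP.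
  have [//|ne] := eqVneq e e'; apply: py_inj => //; apply/eqP.
  rewrite eqn_leq leqNgt [py e' <= _]leqNgt; apply/andP; split; apply: neg => //; first by move/eqP: ne.
  by move=> h; rewrite h eqxx in ne.
- move=> e Ae; rewrite inE => nfe; have [f ff fe] := fav_ex e Ae.
  exists f; rewrite ?inE // /better fe eqxx /= ltn_neqAle.
  have [Af /forall_inP/(_ e Ae)] := andP ff; rewrite fe eqxx /= => ->.
  rewrite andbT; apply/orP; left; apply: contraNneq nfe => pfe.
  by rewrite -(px_inj fe pfe).
Qed.

(** A colour [a] is given to a stable matching [K] of the edges that have [a] in their lists. Any
    other edge that loses [a] is dominated by an edge of [K], so it also loses a better edge and the
    strict inequality survives. *)
Lemma galvin (C : finType) (c0 : C) (L : E -> {set C}) A :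
  (forall e, e \in A -> #|[set e' in A | better e e']| < #|L e|) ->
  exists c : E -> C, (forall e, e \in A -> c e \in L e) /\
    {in A &, forall e e', e != e' -> (fx e = fx e') \/ (fy e = fy e') -> c e != c e'}.
Proof.
have [n] := ubnP #|A|; elim: n A L => // n IH A L ltn HL.
have [->|[e0 Ae0]] := set_0Vmem A.
  by exists (fun _ => c0); split=> [e|e e']; rewrite inE.
have /card_gt0P[a La] := leq_ltn_trans (leq0n _) (HL e0 Ae0).
have [K [KA Kx Ky Kd]] := stable_matching [set e in A | a \in L e].
have KP k : k \in K -> k \in A /\ a \in L k.
  by move/(subsetP KA); rewrite inE => /andP.
have [k0 Kk0] : exists k, k \in K.
  have [Ke|nKe] := boolP (e0 \in K); first by exists e0.
  by have [|k Kk _] := Kd e0 _ nKe; [rewrite inE Ae0|exists k].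
case: (IH (A :\: K) (fun e => L e :\ a)) => [|e /setDP[Ae nKe]|c [cL cP]].
- rewrite -ltnS; apply: leq_trans ltn; rewrite ltnS; apply: proper_card.
  apply/properP; split; first exact: subsetDl.
  by have [Ak _] := KP _ Kk0; exists k0; rewrite // inE Kk0.
- have sub : [set e' in A :\: K | better e e'] \subset [set e' in A | better e e'].
    by apply/subsetP => e'; rewrite !inE => /andP[/andP[_ ->]].
  have := HL e Ae; rewrite (cardsD1 a (L e)); case: (boolP (a \in L e)) => [Lea|_].
    rewrite add1n ltnS; apply: leq_trans; apply: proper_card; apply/properP; split=> //.
    have [|k Kk bk] := Kd e _ nKe; first by rewrite inE Ae.
    by exists k; rewrite !inE ?Kk // bk (KP k Kk).1.
  by rewrite add0n; apply: leq_ltn_trans; apply: subset_leq_card.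
exists (fun e => if e \in K then a else c e); split.
  move=> e Ae; case: ifP => [/KP[]//|nK].
  by have := cL e; rewrite !inE nK Ae => /(_ isT) /andP[].
have cna e : e \in A -> e \notin K -> c e != a.
  by move=> Ae nK; have := cL e; rewrite !inE nK Ae => /(_ isT) /andP[].
move=> e e' Ae Ae' ne adj; case: ifP => [Ke|nKe]; case: ifP => [Ke'|nKe'].
- by case: adj => [/(Kx _ _ Ke Ke')|/(Ky _ _ Ke Ke')] ee'; rewrite ee' eqxx in ne.
- by rewrite eq_sym cna ?nKe'.
- by rewrite cna ?nKe.
- by apply: cP; rewrite ?inE ?nKe ?nKe'.
Qed.
End Stable.

Lemma bipartite_list_coloring (C : finType) (c0 : C) (L : E -> {set C}) i A :
  (forall x, dx A x <= i) ->
  (forall e, e \in A -> i <= dy A (fy e) <= #|L e|) ->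
  exists c : E -> C, (forall e, e \in A -> c e \in L e) /\
    {in A &, forall e e', e != e' -> (fx e = fx e') \/ (fy e = fy e') -> c e != c e'}.
Proof.
move=> lex ley.
have led P : #|[set e in A | P e]| <= #|E| by apply: max_card.
have [||r [rlt rinj rcnt]] := @edge_ranks i #|E| A _ _ (fun y => led _).
- by move=> x; rewrite leq_min lex led.
- by move=> e /ley/andP[h _]; apply: leq_trans (geq_minl _ _) h.
pose n := #|E|.
pose er (e : E) : nat := enum_rank e.
have erlt e : er e < n by apply: ltn_ord.
have erinj e e' : er e = er e' -> e = e' by move/val_inj/enum_rank_inj.
(* Ties are broken by [enum_rank] to make preferences injective. As [r e < n], the subtraction in
   [py] reverses the order of ranks. *)
pose px e := r e * n + er e.
have rmax e : e \in A -> r e < n by move=> Ae; apply: leq_trans (rlt e Ae) (led _).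
pose py e := (n - r e) * n + er e.
have lexi a b e e' : a * n + er e = b * n + er e' -> e = e'.
  move=> h; apply: erinj.
  have := congr1 (fun k => k %% n) h.
  by rewrite !modnMDl !modn_small.
have lt_lexi a b e e' : a * n + er e' < b * n + er e -> a <= b.
  move=> lt; rewrite leqNgt; apply/negP => ba; move: lt; rewrite ltnNge => /negP[].
  apply: (@leq_trans (b.+1 * n)); first by rewrite mulSn addnC leq_add2r ltnW.
  by apply: leq_trans (leq_addr _ _); rewrite leq_mul2r ba orbT.
apply: (@galvin px py _ _ C c0 L A) => [e e' _|e e' _|e Ae]; [exact: lexi..|].
have [ylo yhi] := andP (ley e Ae); apply: leq_trans yhi.
(* At its end in [X], [e] has at most [r e] better edges, ties included; at its end in [Y], they
   have distinct ranks strictly between [r e] and the degree. *)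
have sub : [set e' in A | better px py e e'] \subset
    ([set e' in A | (fx e' == fx e) && (r e' <= r e)] :\ e) :|:
    [set e' in A | (fy e' == fy e) && (r e < r e')].
  apply/subsetP => e'; rewrite !inE /better => /andP[Ae' /orP[/andP[ex lt]|/andP[ey lt]]].
    rewrite Ae' ex /= (lt_lexi _ _ _ _ lt) andbT; apply/orP; left.
    by apply: contraTneq lt => ->; rewrite ltnn.
  rewrite Ae' ey /= ltn_neqAle; apply/orP; right; apply/andP; split.
    apply: contraTneq lt => rr; have -> : e' = e by apply: rinj => //; apply/eqP.
    by rewrite ltnn.
  have := lt_lexi _ _ _ _ lt.
  by rewrite leq_sub2lE // ltnW // rmax.
apply: leq_ltn_trans (subset_leq_card sub) _.
apply: leq_ltn_trans (leq_card_setU _ _) _.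
set U := (X in #|X :\ e|); set V := (X in _ + #|X|).
have leU : #|U :\ e| <= r e.
  have := rcnt (fx e) (r e); rewrite -/U (cardsD1 e) /U inE Ae eqxx leqnn /= add1n ltnS.
  by [].
apply: leq_ltn_trans (leq_add leU (leqnn _)) _.
have leV : #|V| <= dy A (fy e) - (r e).+1.
  rewrite cardE -(size_map r) -[X in _ <= X](size_iota (r e).+1).
  apply: uniq_leq_size => [|_ /mapP[e' + ->]]; last first.
    rewrite mem_enum mem_iota subnKC ?rlt // inE => /and3P[Ae' /eqP <- ->].
    exact: rlt.
  rewrite map_inj_in_uniq ?enum_uniq // => e1 e2; rewrite !mem_enum !inE.
  move=> /and3P[A1 /eqP y1 _] /and3P[A2 /eqP y2 _].
  by apply: rinj => //; rewrite y1.
apply: leq_ltn_trans (leq_add (leqnn _) leV) _.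
by rewrite -addSn subnKC // rlt.
Qed.
End Bipartite.

(** * List edge colourings of sparse graphs *)

Section EdgeLists.
Variables (T C : finType) (c0 : C) (L : T -> T -> {set C}).
Hypothesis L_sym : forall u v, L u v = L v u.

(** Twice the bound [m <= 3 n], for all subgraphs so that it survives deletions. Isolated vertices
    are not counted, since deletions keep the vertex type and would otherwise weaken the bound. *)
Definition sparse (F0 : rel T) := forall F : rel T, symmetric F -> subrel F F0 ->
  \sum_v degree F v <= 6 * #|[set v | 0 < degree F v]|.

Definition list_colorable (F : rel T) := exists ec : T -> T -> C,
  (forall u v, F u v -> ec u v = ec v u /\ ec u v \in L u v) /\
  (forall u v w, F u v -> F u w -> v <> w -> ec u v <> ec u w).

Lemma degree_sub (F G : rel T) v : subrel F G -> degree F v <= degree G v.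
Proof. by move=> FG; apply/subset_leq_card/subsetP => u; rewrite !inE => /FG. Qed.

Lemma card_imset_degree (F : rel T) (f : T -> C) v :
  #|[set f w | w in [set w | F v w]]| <= degree F v.
Proof. exact: leq_imset_card. Qed.

Lemma extend_light_edge (F : rel T) u v : symmetric F -> irreflexive F -> F u v ->
  degree F u + degree F v < #|L u v|.+2 ->
  list_colorable [rel x y | F x y && ((x, y) != (u, v)) && ((x, y) != (v, u))] ->
  list_colorable F.
Proof.
move=> symF irrF Fuv light; set F' := (X in list_colorable X) => -[ec [ecL ecP]].
have neq_uv : u != v by apply: contraTneq Fuv => ->; rewrite irrF.
have degF' w z : F w z -> ((w, z) == (u, v)) || ((w, z) == (v, u)) -> (degree F' w).+1 <= degree F w.
  move=> Fwz wz; apply: proper_card; apply/properP; split.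
    by apply/subsetP => t; rewrite !inE /= => /andP[/andP[]].
  exists z; rewrite !inE // /F' /= Fwz /=.
  by case/orP: wz => /eqP->; rewrite eqxx ?andbF.
pose B w := [set ec w z | z in [set z | F' w z]].
have [a La] : exists2 a, a \in L u v & a \notin B u :|: B v.
  apply/subsetPn; apply: contraTN light => /subset_leq_card leL; rewrite -leqNgt.
  have := degF' u v Fuv; rewrite eqxx => /(_ isT) d1.
  have := degF' v u; rewrite symF Fuv eqxx orbT => /(_ isT isT) d2.
  apply: leq_trans (leq_add d1 d2); rewrite addSn addnS !ltnS.
  apply: leq_trans leL (leq_trans (leq_card_setU _ _) (leq_add _ _));
  exact: card_imset_degree.
rewrite !inE negb_or => /andP[naBu naBv].
have nau z : F' u z -> ec u z <> a.
  by move=> Fz ea; case/negP: naBu; rewrite -ea imset_f // inE.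
have nav z : F' v z -> ec v z <> a.
  by move=> Fz ea; case/negP: naBv; rewrite -ea imset_f // inE.
pose isuv x y := ((x, y) == (u, v)) || ((x, y) == (v, u)).
have isuv_sym x y : isuv x y = isuv y x by rewrite /isuv !xpair_eqE orbC; congr (_ || _); rewrite andbC.
have F'E x y : F x y -> ~~ isuv x y -> F' x y by move=> Fxy; rewrite negb_or /F' /= Fxy.
exists (fun x y => if isuv x y then a else ec x y); split=> [x y Fxy|x y z Fxy Fxz nyz].
  rewrite isuv_sym; case: ifP => [|nxy].
    by case/orP=> /eqP[-> ->]; split=> //; rewrite L_sym.
  by apply: ecL; rewrite F'E // isuv_sym nxy.
have aux x' y' z' : F x' z' -> isuv x' y' -> ~~ isuv x' z' -> ec x' z' <> a.
  move=> Fz xy nz; have := F'E _ _ Fz nz.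
  by case/orP: xy => /eqP[-> _]; [apply: nau|apply: nav].
case: ifP => xy; case: ifP => xz.
- case: nyz; case/orP: xy => /eqP[? ?]; subst; case/orP: xz => /eqP[] //.
    by move=> uv; rewrite uv eqxx in neq_uv.
  by move=> uv; rewrite uv eqxx in neq_uv.
- by move/esym; apply: (aux _ y) => //; rewrite xz.
- by apply: (aux _ z) => //; rewrite xy.
- by apply: ecP => //; apply: F'E; rewrite ?xy ?xz.
Qed.

(* The edges at [X] keep lists of size at least their number at the other end, so
   that they form a list colourable bipartite graph. *)
Lemma extend_alternating (F : rel T) (X : {set T}) i : symmetric F ->
  (forall x y, x \in X -> F x y -> y \notin X) ->
  (forall x, x \in X -> degree F x <= i) ->
  (forall x y, x \in X -> F x y -> i <= #|[set z in X | F y z]|) ->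
  (forall x y, F x y -> degree F x <= #|L x y|) ->
  list_colorable [rel x y | [&& F x y, x \notin X & y \notin X]] ->
  list_colorable F.
Proof.
move=> symF indX degX richX FL; set F' := (X in list_colorable X) => -[ec [ecL ecP]].
pose A := [set p : T * T | (p.1 \in X) && F p.1 p.2].
pose B y := [set ec y w | w in [set w | F' y w]].
(* Only the end outside [X] can meet edges already coloured: [X] is independent, so all edges at its
   vertices are still to be coloured. *)
pose L' (p : T * T) := L p.1 p.2 :\: B p.2.
have dxA x : dx fst A x <= i.
  have [Xx|nXx] := boolP (x \in X); last first.
    rewrite /dx (_ : [set _ in _ | _] = set0) ?cards0 //; apply/setP => p; rewrite !inE.
    by apply/negbTE/negP => /andP[/andP[h _] /eqP p1]; rewrite -p1 h in nXx.
  apply: leq_trans (degX x Xx); rewrite /dx /degree.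
  rewrite -(card_in_imset (f := snd)).
    apply/subset_leq_card/subsetP => y /imsetP[[x' y']]; rewrite !inE /=.
    by move=> /andP[/andP[_ Fxy] /eqP xx] ->; rewrite -xx.
  move=> [x1 y1] [x2 y2]; rewrite !inE /= => /andP[_ /eqP->] /andP[_ /eqP->].
  by move=> ->.
have dyA y : dy snd A y = #|[set z in X | F y z]|.
  rewrite -(card_imset _ (f := fun z => (z, y))); last by move=> z z' [].
  apply: eq_card => -[x y']; rewrite !inE /=; apply/idP/imsetP => [|[z]].
    by move=> /andP[/andP[Xx Fxy] /eqP yy]; exists x; rewrite ?yy // inE Xx -yy symF.
  by rewrite inE => /andP[Xz Fyz] [-> ->]; rewrite Xz symF Fyz eqxx.
have [|c [cL cP]] := @bipartite_list_coloring _ _ _ fst snd C c0 L' i A dxA.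
  move=> [x y]; rewrite inE /= => /andP[Xx Fxy]; rewrite dyA (richX x) //=.
  have nXy := indX x y Xx Fxy.
  have degy : degree F y = #|[set z in X | F y z]| + degree F' y.
    rewrite /degree -(cardsID X [set u | F y u]); congr (_ + _).
      by apply: eq_card => z; rewrite !inE andbC.
    by apply: eq_card => z; rewrite !inE /F' /= nXy andbC.
  rewrite -(leq_add2r (degree F' y)) -degy.
  apply: leq_trans (_ : #|L x y| <= _); first by rewrite L_sym FL // symF.
  rewrite /L' /= -(cardsID (B y) (L x y)) addnC leq_add2l.
  apply: leq_trans (subset_leq_card (subsetIr _ _)) _; exact: card_imset_degree.
pose ec' x y := if x \in X then c (x, y) else if y \in X then c (y, x) else ec x y.
have ec'L x y : x \in X -> F x y -> c (x, y) \in L x y.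
  by move=> Xx Fxy; have := cL (x, y); rewrite !inE Xx Fxy /= => /(_ isT) /andP[].
have cA x y : x \in X -> F x y -> (x, y) \in A by move=> Xx Fxy; rewrite inE Xx.
have cB x y z : x \in X -> F x y -> F' y z -> c (x, y) <> ec y z.
  move=> Xx Fxy Fyz; have := cL (x, y); rewrite !inE Xx Fxy /= => /(_ isT) /andP[nB _] e.
  by case/negP: nB; rewrite e imset_f // inE.
exists ec'; rewrite /ec'; split=> [x y Fxy|x y z Fxy Fxz nyz].
  case: ifP => Xx; first by rewrite (negbTE (indX _ _ Xx Fxy)) ec'L.
  case: ifP => Xy; first by rewrite L_sym ec'L // symF.
  by apply: ecL; rewrite /F' /= Fxy Xx Xy.
case: ifP => Xx.
  apply/eqP; apply: cP; rewrite ?cA //; last by left.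
  by apply/eqP => -[].
case: ifP => Xy; case: ifP => Xz.
- apply/eqP; apply: cP; rewrite ?cA 1?symF //; last by right.
  by apply/eqP => -[].
- by apply: cB; rewrite // 1?symF // /F' /= Fxz Xx Xz.
- by apply/nesym/cB; rewrite // 1?symF // /F' /= Fxy Xx Xy.
- by apply: ecP; rewrite // /F' /= ?Fxy ?Fxz Xx ?Xy ?Xz.
Qed.

(** The at most [d] neighbours of [y] in the current set are charged to [y] and removed; [y] has
    then no neighbour left, so it is never charged again. *)
Lemma peel (F : rel T) d (X0 : {set T}) :
  (forall X : {set T}, X \subset X0 -> X != set0 ->
     exists x y, [/\ x \in X, F x y & #|[set z in X | F z y]| <= d]) ->
  #|X0| <= d * #|[set y | [exists x in X0, F x y]]|.
Proof.
have [n] := ubnP #|X0|; elim: n X0 => // n IH X0 ltn HX.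
have [->|X0n] := eqVneq X0 set0; first by rewrite cards0.
have [x [y [X0x Fxy le_d]]] := HX X0 (subxx _) X0n.
pose X1 := X0 :\: [set z in X0 | F z y].
have leX : #|X0| <= d + #|X1|.
  rewrite -(cardsID [set z in X0 | F z y] X0) leq_add2r; apply: leq_trans le_d.
  exact/subset_leq_card/subsetIr.
have leX1 : #|X1| <= d * #|[set y | [exists x in X1, F x y]]|.
  apply: IH => [|X sX]; last by apply: HX; apply: subset_trans sX (subsetDl _ _).
  rewrite -ltnS; apply: leq_trans ltn; apply: proper_card; apply/properP.
  by split; [apply: subsetDl|exists x; rewrite // !inE X0x Fxy].
apply: leq_trans leX _; rewrite [X in _ <= _ * X](cardsD1 y) inE.
have -> : [exists x in X0, F x y] by apply/exists_inP; exists x.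
rewrite mulnDr muln1 leq_add2l; apply: leq_trans leX1 _; rewrite leq_mul2l.
apply/orP; right; apply/subset_leq_card/subsetP => y'; rewrite !inE => /exists_inP[z].
rewrite !inE => /andP[nz X0z] Fz; apply/andP; split; last by apply/exists_inP; exists z.
by apply: contraNneq nz => <-; rewrite X0z.
Qed.

(* Discharging without faces: every vertex [v] starts with [degree F v - 6];
   by [peel], each vertex of degree at most 5 can be given 4 by a neighbour of
   degree at least 24, no neighbour paying more than 16. *)
Lemma sparse_reducible (F : rel T) : symmetric F -> irreflexive F -> sparse F ->
  (forall u v, F u v -> 29 <= degree F u + degree F v) ->
  (forall u v, F u v -> 1 < degree F u) ->
  (exists u v, F u v) ->
  exists X : {set T}, [/\ X != set0, forall x, x \in X -> 0 < degree F x <= 5 &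
    forall x y, x \in X -> F x y -> 5 <= #|[set z in X | F y z]|].
Proof.
move=> symF irrF spF heavy deg2 [u0 [v0 F0]].
have [//|nX] := pselect (exists X : {set T}, [/\ X != set0, forall x, x \in X -> 0 < degree F x <= 5 &
    forall x y, x \in X -> F x y -> 5 <= #|[set z in X | F y z]|]).
have degE u : 0 < degree F u -> exists v, F u v.
  by case/card_gt0P => v; rewrite inE; exists v.
exfalso; pose X5 := [set v | 0 < degree F v <= 5].
pose Y := [set y | [exists x in X5, F x y]].
pose P := [set v | 0 < degree F v].
have leX : #|X5| <= 4 * #|Y|.
  (* If no [y] can be peeled from [X], each neighbour of [X] has at least 5 neighbours in it, and
     [X] is the set excluded by [nX]. *)
  apply: peel => X sX Xn; have [//|nex] := pselect (exists x y, [/\ x \in X, F x y & #|[set z in X | F z y]| <= 4]).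
  case: nX; exists X; split=> // [x /(subsetP sX)|x y Xx Fxy]; first by rewrite inE.
  rewrite ltnNge; apply/negP => le4; case: nex; exists x, y; split=> //.
  by rewrite (eq_card (B := [set z in X | F y z])) // => z; rewrite !inE symF.
have leS : \sum_(v in P) degree F v <= 6 * #|P|.
  apply: leq_trans (spF F symF _); last by [].
  by rewrite [X in _ <= X](bigID (mem P)) leq_addr.
have sumP k (B : {set T}) : B \subset P -> \sum_(v in P) k * (v \in B) = k * #|B|.
  move=> sB; rewrite -sum1_card big_distrr [RHS]big_mkcond [LHS]big_mkcond.
  apply: eq_bigr => v _ /=; have := subsetP sB v.
  by case: (v \in B) => [->|_] //; case: ifP; rewrite ?muln0.
have Y24 v : v \in Y -> 24 <= degree F v.
  rewrite inE => /exists_inP[x]; rewrite inE => /andP[_ le5] /heavy le29.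
  by rewrite -(leq_add2l 5); apply: leq_trans le29 _; rewrite leq_add2r.
have sXP : X5 \subset P by apply/subsetP => v; rewrite !inE => /andP[].
have sYP : Y \subset P by apply/subsetP => v /Y24; rewrite inE; apply: leq_trans.
have pt v : v \in P -> 6 + 18 * (v \in Y) <= degree F v + 4 * (v \in X5).
  move=> Pv; have [/Y24 d24|nY] := boolP (v \in Y).
    by apply: leq_trans d24 (leq_addr _ _).
  rewrite muln0 addn0; rewrite inE in Pv; rewrite inE Pv /=.
  have [le5|lt5] := leqP (degree F v) 5; last by rewrite muln0 addn0.
  by have [w Fvw] := degE v Pv; rewrite muln1 -[6]/(2 + 4) leq_add2r (deg2 _ w).
have : \sum_(v in P) (6 + 18 * (v \in Y)) <= \sum_(v in P) (degree F v + 4 * (v \in X5)).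
  exact: leq_sum.
rewrite big_split [X in _ <= X]big_split (sumP _ _ sYP) (sumP _ _ sXP) /= sum_nat_const mulnC => le1.
(* The surplus 18 of each vertex of [Y] exceeds the 16 that it pays. *)
have Y0 : #|Y| = 0.
  have : 6 * #|P| + 18 * #|Y| <= 6 * #|P| + 16 * #|Y|.
    apply: leq_trans le1 _; apply: leq_add => //.
    by rewrite -[16]/(4 * 4) -mulnA leq_mul2l.
  by rewrite leq_add2l leq_mul2r => /orP[/eqP|].
have X0 : X5 = set0.
  by apply/eqP; rewrite -cards_eq0 -leqn0; apply: leq_trans leX _; rewrite Y0.
(* Now all positive degrees are at least 6, so one degree above 6 contradicts the bound; an edge has
   such an end because [29 > 6 + 6]. *)
have [w dw] : exists w, 6 < degree F w.
  have := heavy _ _ F0; have [|le6 h] := ltnP 6 (degree F u0); first by exists u0.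
  exists v0; rewrite -(leq_add2l 6); apply: leq_trans (leq_trans _ h) _ => //.
  by rewrite leq_add2r.
have Pw : w \in P by rewrite inE; apply: leq_trans dw.
have : \sum_(v in P) (6 + (v == w)) <= \sum_(v in P) degree F v.
  apply: leq_sum => v Pv; have [->//|_] := eqVneq v w; rewrite addn0.
  have : v \notin X5 by rewrite X0 inE.
  by rewrite !inE in Pv *; rewrite Pv /= -ltnNge.
move/leq_trans/(_ leS); rewrite big_split /= sum_nat_const mulnC (bigD1 w) //= eqxx.
by rewrite addnA addn1 addSn ltnNge leq_addr.
Qed.

Lemma sparse_list_colorable (F : rel T) : symmetric F -> irreflexive F -> sparse F ->
  (forall u v, F u v -> 27 <= #|L u v|) ->
  (forall u v, F u v -> degree F u <= #|L u v|) ->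
  list_colorable F.
Proof.
have [n] := ubnP #|[set p : T * T | F p.1 p.2]|.
elim: n F => // n IH F ltn symF irrF spF L27 FL.
have IHs (F' : rel T) x y : symmetric F' -> subrel F' F -> F x y -> ~~ F' x y -> list_colorable F'.
  move=> symF' sF Fxy nF'; apply: IH => //.
  - rewrite -ltnS; apply: leq_trans ltn; apply: proper_card; apply/properP; split.
      by apply/subsetP => p; rewrite !inE; apply: sF.
    by exists (x, y); rewrite !inE.
  - by move=> z; apply/negbTE/negP => /sF; rewrite irrF.
  - by move=> G symG sG; apply: spF => // u v /sG/sF.
  - by move=> u v /sF/L27.
  - by move=> u v Fuv; apply: leq_trans (degree_sub u sF) (FL u v (sF _ _ Fuv)).
have [/existsP[u /existsP[v /andP[Fuv light]]]|heavy] :=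
  boolP [exists u, exists v, F u v && (degree F u + degree F v < #|L u v|.+2)].
  apply: (extend_light_edge symF irrF Fuv light).
  apply: (IHs _ u v) => //= [x y|x y /andP[/andP[]] //|]; last by rewrite eqxx andbF.
  by rewrite /= symF -!andbA; congr (_ && _); rewrite andbC !xpair_eqE ![(y == _) && _]andbC.
have {}heavy u v : F u v -> #|L u v|.+2 <= degree F u + degree F v.
  move=> Fuv; rewrite leqNgt; apply: contra heavy => lt.
  by apply/existsP; exists u; apply/existsP; exists v; rewrite Fuv.
have [[u0 [v0 F0]]|noF] := pselect (exists u v, F u v); last first.
  by exists (fun _ _ => c0); split=> [u v Fuv|u v w Fuv]; case: noF; exists u, v.
have heavy29 u v : F u v -> 29 <= degree F u + degree F v.
  by move=> Fuv; apply: leq_trans (heavy u v Fuv); rewrite !ltnS L27.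
have [||X [Xn X5 XF]] := @sparse_reducible F symF irrF spF heavy29.
(* If [degree F u <= 1], then [degree F v <= #|L u v|] makes [uv] an edge that can be coloured
   last. *)
- move=> u v Fuv; have h := heavy u v Fuv; rewrite ltnNge; apply: contraTN h => le1.
  rewrite -ltnNge; apply: leq_ltn_trans (leq_add le1 (leqnn _)) _.
  by rewrite add1n !ltnS L_sym FL // symF.
- by exists u0, v0.
have [x Xx] := set0Pn _ Xn; have [/card_gt0P[y]] := andP (X5 x Xx).
rewrite inE => Fxy _.
have indX z t : z \in X -> F z t -> t \notin X.
  move=> Xz /heavy29 h; apply: contraTN h => Xt; rewrite -ltnNge.
  have [_ dz] := andP (X5 z Xz); have [_ dt] := andP (X5 t Xt).
  by apply: leq_ltn_trans (leq_add dz dt) _.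
apply: (extend_alternating symF indX _ XF FL) => [z /X5/andP[] //|].
apply: (IHs _ x y) => //= [z t|z t /and3P[] //|]; last by rewrite Xx andbF.
by rewrite /= symF [X in _ && X]andbC.
Qed.
End EdgeLists.

(** * Planar graphs *)

Section OrientedEdges.
Variables (T : finType) (F : rel T).
Hypothesis symF : symmetric F.
Hypothesis irrF : irreflexive F.

Definition oriented (p : T * T) := F p.1 p.2 && (enum_rank p.1 < enum_rank p.2).
Definition edge := {p : T * T | oriented p}.

Lemma sum_degree : \sum_v degree F v = 2 * #|{: edge}|.
Proof.
pose S := [set p : T * T | F p.1 p.2].
have -> : \sum_v degree F v = #|S|.
  rewrite -sum1_card (eq_bigl (fun p => true && F p.1 p.2)); last by move=> p; rewrite inE.
  rewrite -(pair_big_dep xpredT F (fun _ _ => 1)) /=; apply: eq_bigr => v _.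
  by rewrite sum1_card; apply: eq_card => u; rewrite inE.
pose swap (p : T * T) := (p.2, p.1).
have swapK : involutive swap by case.
pose S1 := [set p | oriented p].
have cE : #|{: edge}| = #|S1| by rewrite card_sig; apply: eq_card => p; rewrite !inE.
rewrite cE -(cardsID S1 S) mul2n -addnn; congr (_ + _).
  by apply: eq_card => p; rewrite !inE /oriented; case: (F _ _).
rewrite -[RHS](card_imset _ (inv_inj swapK)); apply: eq_card => p.
apply/idP/imsetP => [|[q]]; rewrite !inE /oriented.
  case/andP=> nlt Fp; exists (swap p); last by rewrite swapK.
  rewrite inE /oriented /= symF Fp /=; move: nlt; rewrite Fp /= -leqNgt leq_eqVlt.
  by case/orP=> // /eqP/val_inj/enum_rank_inj eqp; rewrite eqp irrF in Fp.
by move=> /andP[Fq lt] -> /=; rewrite symF Fq ltnNge (ltnW lt).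
Qed.

Lemma edge_end (v : T) :
  (0 < degree F v) = [exists x : edge, inc (fun x => (val x).1) (fun x => (val x).2) x v].
Proof.
apply/card_gt0P/existsP => [[u]|[[[x y] o]]]; last have /andP[/= Fxy _] := o.
  rewrite inE => Fvu; have [lt|] := boolP (enum_rank v < enum_rank u).
    have o : oriented (v, u) by rewrite /oriented /= Fvu.
    by exists (Sub _ o : edge); rewrite /inc eqxx.
  rewrite -leqNgt leq_eqVlt => /orP[/eqP/val_inj/enum_rank_inj eqp|lt].
    by rewrite eqp irrF in Fvu.
  have o : oriented (u, v) by rewrite /oriented /= symF Fvu.
  by exists (Sub _ o : edge); rewrite /inc eqxx orbT.
case/orP=> /eqP-> /=; first by exists y; rewrite inE.
by exists x; rewrite inE symF.
Qed.
End OrientedEdges.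

(** Orienting the edges selects one of the arcs [arc x y] and [arc y x], which an embedding does not
    require to be disjoint. *)
Lemma planar_sparse (T : finType) (e : rel T) : simple_graph e -> planar e -> sparse e.
Proof.
move=> [_ irr_e] [pos [arc [pos_inj [arcP arc_disj]]]] F symF sF.
have irrF : irreflexive F.
  by move=> v; apply/negbTE/negP => /sF h; have := irr_e v; rewrite h.
rewrite (sum_degree symF irrF) -[6]/(2 * 3) -mulnA leq_mul2l /=.
pose src (x : edge F) := (val x).1; pose tgt (x : edge F) := (val x).2.
have eF x : F (src x) (tgt x) by have /andP[] := valP x.
have lt x : enum_rank (src x) < enum_rank (tgt x) by have /andP[] := valP x.
have ee x : e (src x) (tgt x) := sF _ _ (eF x).
have st x : src x != tgt x.
  by apply: contraTneq (lt x) => h; rewrite h ltnn.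
have simple x y : inc src tgt x =1 inc src tgt y -> x = y.
  move=> h; apply/val_inj; move: (lt x) (lt y) (st x) (h (src x)) (h (tgt x)).
  rewrite /inc !eqxx orbT /src /tgt /=; case: (val x) => a b; case: (val y) => c d /=.
  move=> ab cd nab /esym/orP h1 /esym/orP h2.
  case: h1 => /eqP h1; case: h2 => /eqP h2; subst=> //.
  - by rewrite ltnn in ab.
  - by have := ltn_trans ab cd; rewrite ltnn.
  - by rewrite ltnn in ab.
have [|||||N [cls [disj bnd conn adj]]] :=
  @embedding_grid T (edge F) src tgt pos (fun x => arc (src x) (tgt x)) pos_inj.
- by move=> x; have [_ [_ [c1 [c2 _]]]] := arcP _ _ (ee x).
- by move=> x; have [] := arcP _ _ (ee x).
- by move=> x; have [_ []] := arcP _ _ (ee x).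
- by move=> x z t tt; have [_ [_ [_ [_ [_ h]]]]] := arcP _ _ (ee x); apply: h.
- move=> x y s t nxy ss tt; apply: (arc_disj _ _ _ _ (ee x) (ee y)) ss tt => h.
  apply: nxy; apply: simple => v; rewrite /inc.
  by case: h => -[-> ->] //; rewrite orbC.
have := grid_minor_card disj bnd conn (fun x => adj x (st x)) st simple.
by rewrite (eq_card (B := [set v | 0 < degree F v])) // => v; rewrite !inE edge_end.
Qed.

(** * Extension of a precolouring, with the nonzero elements of ['I_k.+1] as colours *)

Lemma card_nonzero_ord k : #|[set c : 'I_k.+1 | c != ord0]| = k.
Proof.
have := cardsC1 (ord0 : 'I_k.+1); rewrite card_ord /=; apply: etrans.
by apply: eq_card => c; rewrite !inE.
Qed.

Lemma greedy_vertex_coloring (T : finType) (e : rel T) k (vc : T -> nat) (S : {set T}) :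
  simple_graph e -> (forall v, degree e v < k) ->
  (forall v, v \in S -> 1 <= vc v <= k) ->
  (forall u v, u \in S -> v \in S -> e u v -> vc u <> vc v) ->
  exists vc' : T -> nat, [/\ forall v, 1 <= vc' v <= k,
    forall u v, e u v -> vc' u <> vc' v & forall v, v \in S -> vc' v = vc v].
Proof.
move=> [sym_e irr_e] deg; have [n] := ubnP #|~: S|.
elim: n vc S => // n IH vc S ltn range proper.
have [full|[v]] := set_0Vmem (~: S).
  have inS v : v \in S by have /setP/(_ v) := full; rewrite !inE => /negbFE.
  by exists vc; split=> // [v|u v]; [apply: range|apply: proper].
rewrite inE => nSv.
have [a a_range a_new] : exists2 a, 1 <= a <= k & forall u, e v u -> vc u <> a.
  (* Neighbours outside [S] are included with arbitrary values; this is harmless, as [B] still has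
     at most [degree e v < k] elements. *)
  pose B := [set (inord (vc u) : 'I_k.+1) | u in [set u | e v u]].
  have : ~~ ([set c : 'I_k.+1 | c != ord0] \subset B).
    apply/negP => /subset_leq_card; rewrite leqNgt => /negP[].
    by rewrite card_nonzero_ord; apply: leq_ltn_trans (leq_imset_card _ _) (deg v).
  case/subsetPn => c; rewrite inE => c0 nB; exists (c : nat).
    by rewrite lt0n c0 -ltnS ltn_ord.
  move=> u evu vca; case/negP: nB; apply/imsetP; exists u; first by rewrite inE.
  by rewrite vca inord_val.
have [||| vc' [r' p' a']] := IH (fun u => if u == v then a else vc u) (v |: S).
- rewrite -ltnS; apply: leq_trans ltn; apply: proper_card; apply/properP.
  split; first by rewrite setCS subsetUr.
  by exists v; rewrite !inE ?eqxx.
- by move=> u; rewrite !inE; case: eqP => //= _; apply: range.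
- move=> u w; rewrite !inE; case: (u =P v) => [->|_]; case: (w =P v) => [->|_] //=.
  + by rewrite (negbTE (irr_e v)).
  + by move=> _ _ evw /esym; apply: a_new.
  + by move=> _ _; rewrite sym_e; apply: a_new.
  + exact: proper.
exists vc'; split=> // u Su; rewrite a' ?inE ?Su ?orbT //.
by case: eqP => // uv; rewrite -uv Su in nSv.
Qed.

Theorem theorem1p4 (T : finType) (e eH : rel T) :
  simple_graph e -> planar e -> 28 <= max_degree e ->
  matching_subgraph e eH ->
  forall (vc : T -> nat) (ec : T -> T -> nat),
    total_coloring_in e eH (max_degree e + 3) vc ec ->
    extends_to e eH (max_degree e + 3) vc ec.
Proof.
move=> simple_e planar_e D28 [symH [subH matchH]] vc ec [vcR [ecR [vcP _]]].
have [sym_e irr_e] := simple_e.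
set D := max_degree e in D28 *; set k := D + 3 in vcR ecR *.
have degD v : degree e v <= D by apply: leq_bigmax.
pose S := [set v | [exists u, eH v u]].
have SP v : reflect (in_sub eH v) (v \in S) by rewrite inE; apply: existsP.
have [|||vc' [vcR' vcP' vcS]] := @greedy_vertex_coloring T e k vc S simple_e.
- by move=> v; apply: leq_ltn_trans (degD v) _; rewrite /k addnS ltnS leq_addr.
- by move=> v /SP/vcR.
- by move=> u v /SP Su /SP Sv; apply: vcP.
have vcH u v : eH u v -> vc' u = vc u by move=> h; apply/vcS/SP; exists v.
pose F : rel T := [rel u v | e u v && ~~ eH u v].
have symF : symmetric F by move=> u v; rewrite /F /= sym_e symH.
have irrF : irreflexive F by move=> v; rewrite /F /= (negbTE (irr_e v)).
have subF : subrel F e by move=> u v /andP[].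
have spF : sparse F.
  by move=> G symG sG; apply: planar_sparse planar_e _ symG _ => // u v /sG/subF.
have degH v : degree eH v <= 1.
  rewrite leqNgt; apply/negP => /card_gt1P[u [w []]]; rewrite !inE => hu hw.
  by rewrite (matchH _ _ _ hu hw) eqxx.
have degFH v : degree F v + degree eH v <= D.
  apply: leq_trans (degD v); rewrite /degree -(cardsID [set u | eH v u] [set u | e v u]) addnC.
  apply: leq_add; apply/subset_leq_card/subsetP => u; rewrite !inE /F /=.
    by move=> h; rewrite h (subH _ _ h).
  by rewrite andbC.
pose H u := [set (inord (ec u w) : 'I_k.+1) | w in [set w | eH u w]].
pose B u v : {set 'I_k.+1} := [set inord (vc' u); inord (vc' v)] :|: (H u :|: H v).
pose L u v := [set c : 'I_k.+1 | c != ord0] :\: B u v.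
have L_sym u v : L u v = L v u by rewrite /L /B setUC [H u :|: _]setUC setUC [[set _; _]]setUC.
have cardH u : #|H u| <= degree eH u by apply: leq_imset_card.
have cardB u v : #|B u v| <= 2 + (degree eH u + degree eH v).
  apply: leq_trans (leq_card_setU _ _) _; apply: leq_add.
    by rewrite cards2; case: (_ != _).
  by apply: leq_trans (leq_card_setU _ _) _; apply: leq_add.
have cardL u v : D.+1 <= #|L u v| + (degree eH u + degree eH v).
  have := cardsID (B u v) [set c : 'I_k.+1 | c != ord0]; rewrite card_nonzero_ord -/(L u v) => sumk.
  have : k <= 2 + (degree eH u + degree eH v) + #|L u v|.
    rewrite -[X in X <= _]sumk leq_add2r; apply: leq_trans (cardB u v).
    exact/subset_leq_card/subsetIr.
  by rewrite /k; lia.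
have [||ec0 [ec0L ec0P]] := @sparse_list_colorable T 'I_k.+1 ord0 L L_sym F symF irrF spF.
(* This is [27 + 1 + 1 <= D + 1], the place where [D >= 28] is used. *)
- move=> u v _; rewrite -(leq_add2r (degree eH u + degree eH v)).
  apply: leq_trans (cardL u v).
  by apply: leq_trans (leq_add (leqnn 27) (leq_add (degH u) (degH v))) _; rewrite ltnS.
(* Since [degree F u + degree eH u <= D], the [+ 1] in [cardL] pays for the possible edge of [H] at
   [v]. *)
- move=> u v _; rewrite -(leq_add2r (degree eH u + degree eH v)).
  by apply: leq_trans (cardL u v); rewrite addnA -addn1 leq_add.
have ec0_avoid u v : F u v -> [/\ 1 <= ec0 u v <= k, vc' u <> ec0 u v &
    forall w, eH u w -> ec u w <> ec0 u v].
  move=> /ec0L[_]; rewrite !inE !negb_or => /andP[/andP[/andP[nu _] /andP[nH _]] n0].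
  split; first by rewrite lt0n n0 -ltnS ltn_ord.
    by move=> h; case/eqP: nu; apply: val_inj; rewrite /= inordK ?h // ltn_ord.
  move=> w uw h; case/negP: nH; apply/imsetP; exists w; first by rewrite inE.
  by apply: val_inj; rewrite /= inordK ?h // ltn_ord.
exists vc', (fun u v => if eH u v then ec u v else ec0 u v); split; last split.
- split; [exact: vcR'|split] => [u v euv|u v w euv euw nvw].
    rewrite [eH v u]symH; case: ifP => [uv|nuv].
      by have [r s n] := ecR u v uv; split=> //; [rewrite (vcH _ _ uv)|apply: vcP'].
    have Fuv : F u v by rewrite /F /= euv nuv.
    have [r n _] := ec0_avoid u v Fuv; have [s _] := ec0L u v Fuv.
    by split=> //; [rewrite s|apply: vcP'].
  case: ifP => uv; case: ifP => uw.
  + by case: nvw; apply: matchH uv uw.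
  + by have [|_ _ h] := ec0_avoid u w; [rewrite /F /= euw uw|apply: h].
  + by have [|_ _ h] := ec0_avoid u v; [rewrite /F /= euv uv|apply/nesym/h].
  + by move/val_inj; apply: ec0P => //; rewrite /F /= ?euv ?euw ?uv ?uw.
- by move=> v /SP/vcS.
- by move=> u v ->.
Qed.
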